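(* Let $q$ be a prime power and $n\geq 12$ an integer. For an even integer $x$ let $$\begin{aligned}M(x)={}&q^{4(x-5)}+(q^{2x-10}+q^{2x-14})\big(q^{2x-14}+\tfrac{x-8}{2}q^{x-9}\big)+(q^{2x-11}+q^{2x-13})\big(\tfrac{x-8}{2}q^{x-10}+q^{2x-15}\big)\\&+(q^{2x-12}+q^{2x-13})\big(2q^{2x-16}+\tfrac{x-10}{2}q^{x-11}\big)\\&+(q^{2x-12}+q^{2x-14})\Big[\sum_{i=3}^{\min\{\lceil q/2\rceil+2,\lfloor (x-5)/2\rfloor\}}\big(iq^{2x-2i-12}+(\tfrac{x-6}{2}-i)q^{x-2i-7}\big)\\&\qquad+\sum_{i=2}^{\min\{\lfloor q/2\rfloor+2,\lceil (x-7)/2\rceil\}}\big(iq^{2x-2i-13}+(\tfrac{x-6}{2}-i)q^{x-2i-8}\big)\Big],\end{aligned}$$ and for an odd integer $x$ let $$\begin{aligned}M(x)={}&q^{4(x-5)}+(q^{2x-10}+q^{2x-14})\big(q^{2x-14}+\tfrac{x-9}{2}q^{x-8}+q^{\frac{x-9}{2}}\big)+(q^{2x-11}+q^{2x-13})\big(\tfrac{x-9}{2}q^{x-9}+q^{2x-15}+q^{x-8}\big)\\&+(q^{2x-12}+q^{2x-13})\big(q^{2x-16}+\tfrac{x-11}{2}q^{x-10}+q^{\frac{x-11}{2}}\big)\\&+(q^{2x-12}+q^{2x-14})\Big[\sum_{i=3}^{\min\{\lceil q/2\rceil+2,\lfloor (x-5)/2\rfloor\}}\big(iq^{2x-2i-12}+(\tfrac{x-7}{2}-i)q^{x-2i-6}+q^{\frac{x-7}{2}-i}\big)\\&\qquad+\sum_{i=2}^{\min\{\lfloor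 q/2\rfloor+2,\lceil (x-7)/2\rceil\}}\big(iq^{2x-2i-13}+(\tfrac{x-7}{2}-i)q^{x-2i-7}+q^{x-i-7}\big)\Big].\end{aligned}$$ Let $M_1=\sum_{j=0}^{\lfloor (n-12)/5\rfloor} M(n-5j)$. Then $$\bar A_q(n,4,5)\geq M_1+q^4+q^3+q^2+q+1.$$
   Context: $\mathcal G_q(n,k)$ is the set of $k$-dimensional subspaces of $\mathbb F_q^n$, with subspace distance $d_S(\mathcal U,\mathcal V)=\dim\mathcal U+\dim\mathcal V-2\dim(\mathcal U\cap\mathcal V)$; an $(n,d,k)_q$-CDC is a subset of $\mathcal G_q(n,k)$ with pairwise subspace distance at least $d$. An MRD$[k\times(n-k),\delta]_q$ code is an $\mathbb F_q$-linear subspace of $\mathbb F_q^{k\times(n-k)}$ of dimension $\max\{k,n-k\}(\min\{k,n-k\}-\delta+1)$ whose nonzero elements have rank at least $\delta$; a lifted MRD code is $\{\mathrm{rowspace}(\boldsymbol I_k\mid\boldsymbol A):\boldsymbol A\in\mathcal D\}$ for such $\mathcal D$. $\bar A_q(n,2\delta,k)$ is the maximum size of an $(n,2\delta,k)_q$-CDC containing a lifted MRD code as a subset (here $k=5$, $\delta=2$). *)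

(* Defs.v *)
From HB Require Import structures.
From mathcomp Require Import all_boot all_order all_algebra all_field.

Set Implicit Arguments.
Unset Strict Implicit.
Unset Printing Implicit Defensive.

Import Order.TTheory GRing.Theory Num.Theory.
Local Open Scope ring_scope.

Section FiniteVspace.
Import VectorInternalTheory.
Variables (F : finFieldType) (vT : vectType F).
HB.instance Definition _ := [Countable of {vspace vT} by <:].
HB.instance Definition _ := [Finite of {vspace vT} by <:].
End FiniteVspace.

Section SubspaceCodes.

Variable F : finFieldType.

Definition subspace_dist (n : nat) (U V : {vspace 'rV[F]_n}) : nat :=
  (\dim U + \dim V - 2 * \dim (U :&: V))%N.

Definition grassmannian (n k : nat) : {set {vspace 'rV[F]_n}} :=
  [set U | \dim U == k].

Definition is_CDC (n d k : nat) (C : {set {vspace 'rV[F]_n}}) : bool :=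
  (C \subset grassmannian n k) &&
  [forall U in C, forall V in C, (U != V) ==> (d <= subspace_dist U V)%N].

Definition is_MRD (k m delta : nat) (D : {vspace 'M[F]_(k, m)}) : bool :=
  (\dim D == maxn k m * ((minn k m).+1 - delta))%N &&
  [forall A in D, (A != 0) ==> (delta <= \rank A)%N].

Definition rowspace (k n : nat) (B : 'M[F]_(k, n)) : {vspace 'rV[F]_n} :=
  <<[seq row i B | i : 'I_k]>>%VS.

(* (I_k | A) has k + (n - k) columns. For k <= n, conform_mx casts it to width  *)
(* n; its default value 0 is only returned in the meaningless case n < k.       *)
Definition lift_mx (n k : nat) (A : 'M[F]_(k, n - k)) : 'M[F]_(k, n) :=
  conform_mx 0 (row_mx 1%:M A).

Definition lifted_code (n k : nat) (D : {vspace 'M[F]_(k, n - k)}) :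
    {set {vspace 'rV[F]_n}} :=
  [set rowspace (lift_mx A) | A in D].

(* Maximum size of a CDC containing a lifted MRD code; d stands for 2 * delta,  *)
(* and the MRD code has rank distance delta = d / 2.                            *)
Definition Abar (n d k : nat) : nat :=
  \max_(C : {set {vspace 'rV[F]_n}} |
      is_CDC d k C &&
      [exists D : {vspace 'M[F]_(k, n - k)},
         is_MRD d./2 D && (lifted_code D \subset C)]) #|C|.

End SubspaceCodes.

(* The bound is computed in rat with integer exponents: for odd x and           *)
(* i = (x - 5) / 2 the first bracketed sum contains - q ^ (-1) + q ^ (-1), so   *)
(* truncated natural-number subtraction would change its value. In the summation *)
(* bounds, uphalf and _./2 are the ceiling and the floor of one half; there     *)
(* x - 5 and x - 7 are natural-number differences, exact since only x >= 12     *)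
(* matters. The divisions %/ in the exponents of M_odd are exact for odd x.     *)

Definition M_even (q x : nat) : rat :=
  let Q : rat := q%:R in
  let y : rat := x%:R in
  let e : int := x in
    Q ^ (4 * (e - 5))
  + (Q ^ (2 * e - 10) + Q ^ (2 * e - 14))
    * (Q ^ (2 * e - 14) + (y - 8) / 2 * Q ^ (e - 9))
  + (Q ^ (2 * e - 11) + Q ^ (2 * e - 13))
    * ((y - 8) / 2 * Q ^ (e - 10) + Q ^ (2 * e - 15))
  + (Q ^ (2 * e - 12) + Q ^ (2 * e - 13))
    * (2 * Q ^ (2 * e - 16) + (y - 10) / 2 * Q ^ (e - 11))
  + (Q ^ (2 * e - 12) + Q ^ (2 * e - 14))
    * (\sum_(3 <= i < (minn (uphalf q + 2) (x - 5)./2).+1)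
          (i%:R * Q ^ (2 * e - 2 * i%:Z - 12)
           + ((y - 6) / 2 - i%:R) * Q ^ (e - 2 * i%:Z - 7))
       + \sum_(2 <= i < (minn (q./2 + 2) (uphalf (x - 7))).+1)
          (i%:R * Q ^ (2 * e - 2 * i%:Z - 13)
           + ((y - 6) / 2 - i%:R) * Q ^ (e - 2 * i%:Z - 8))).

Definition M_odd (q x : nat) : rat :=
  let Q : rat := q%:R in
  let y : rat := x%:R in
  let e : int := x in
    Q ^ (4 * (e - 5))
  + (Q ^ (2 * e - 10) + Q ^ (2 * e - 14))
    * (Q ^ (2 * e - 14) + (y - 9) / 2 * Q ^ (e - 8)
       + Q ^ ((e - 9) %/ 2)%Z)
  + (Q ^ (2 * e - 11) + Q ^ (2 * e - 13))
    * ((y - 9) / 2 * Q ^ (e - 9) + Q ^ (2 * e - 15) + Q ^ (e - 8))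
  + (Q ^ (2 * e - 12) + Q ^ (2 * e - 13))
    * (Q ^ (2 * e - 16) + (y - 11) / 2 * Q ^ (e - 10)
       + Q ^ ((e - 11) %/ 2)%Z)
  + (Q ^ (2 * e - 12) + Q ^ (2 * e - 14))
    * (\sum_(3 <= i < (minn (uphalf q + 2) (x - 5)./2).+1)
          (i%:R * Q ^ (2 * e - 2 * i%:Z - 12)
           + ((y - 7) / 2 - i%:R) * Q ^ (e - 2 * i%:Z - 6)
           + Q ^ (((e - 7) %/ 2)%Z - i%:Z))
       + \sum_(2 <= i < (minn (q./2 + 2) (uphalf (x - 7))).+1)
          (i%:R * Q ^ (2 * e - 2 * i%:Z - 13)
           + ((y - 7) / 2 - i%:R) * Q ^ (e - 2 * i%:Z - 7)
           + Q ^ (e - i%:Z - 7))).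

Definition M (q x : nat) : rat := if odd x then M_odd q x else M_even q x.

Definition M1 (q n : nat) : rat :=
  \sum_(0 <= j < ((n - 12) %/ 5).+1) M q (n - 5 * j).

(* Main.v *)
From HB Require Import structures.
Require Import Defs.
From mathcomp Require Import all_boot all_order all_algebra all_fingroup all_solvable all_field.
From mathcomp Require Import zify ring lra.
Set Implicit Arguments.
Unset Strict Implicit.
Unset Printing Implicit Defensive.
Import Order.TTheory GRing.Theory Num.Theory.
Local Open Scope ring_scope.

(** Let S be the space of vectors of F^(m+5) whose first five coordinates vanish.
A 5-space meeting S in dimension at least 2 is at distance at least 4 from every
lifted matrix, so a lifted MRD code may be enlarged by 5-spaces U with
dim (U :&: S) = 2 and by any code inside S; this gives the recursion n -> n - 5
and the sum M1, and it stops with q^5 > q^4 + q^3 + q^2 + q + 1 words.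

The 5-spaces with dim (U :&: S) = 2 come from Ferrers diagram codes: fix pivots
(three among the first five columns, two columns 4 + a < 4 + b of S), let the rows
other than the first be free in their dots, and let the first row be minus the sum
of the others multiplied by elements of F_(q^N) linearly independent over F, where
N is the number of dots of the first row.  Two words then differ by a matrix of
rank at least 2.  Two cells whose pivot sets share at most 3 columns are at
distance at least 4, because leading positions of vectors in the intersection lie
in both pivot sets.

The pairs a < b of a given class s have sum s modulo the largest odd number M <= m
(when m is even, m is matched with the a such that 2 a = s mod M), so the pairs in
one class are disjoint and distinct classes share no pair.  Class s is combined
with two head pivot sets having one common column; distinct classes get distinct
head pivot sets, except that the classes s >= 7 share theirs and are told apart by
the value in F of one fixed entry (a pending dot), which leaves q + 1 classes
s = 6, ..., q + 6 of the last type. *)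

(** * Finite field extensions *)

Lemma natr_card (F : finFieldType) : (#|F|)%:R = 0 :> F.
Proof.
have := expg_cardG (in_setT (1 : F)).
by rewrite cardsT FinRing.zmodXgE.
Qed.

Lemma separable_Xq_sub_X (F : finFieldType) (L : fieldExtType F) (k : nat) :
  (0 < k)%N -> separable_poly ('X^(#|F| ^ k) - 'X : {poly L}).
Proof.
move=> k_gt0; rewrite separable_poly.unlock derivB derivXn derivX.
have -> : 'X^((#|F| ^ k).-1) *+ (#|F| ^ k) = 0 :> {poly L}.
  rewrite -mulr_natr -polyC_natr natrX -(rmorph_nat (in_alg L)) natr_card.
  by rewrite rmorph0 expr0n gtn_eqF // polyC0 mulr0.
by rewrite sub0r -(scaleN1r 1) (eqp_coprimepr _ (eqp_scale _ _)) ?coprimep1 // oppr_eq0 oner_eq0.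
Qed.

Lemma exists_field_ext (F : finFieldType) (k : nat) :
  (0 < k)%N -> exists L : fieldExtType F, \dim {:L} = k.
Proof.
move=> k_gt0; set m := (#|F| ^ k)%N.
have m_gt1 : (1 < m)%N by rewrite (ltn_exp2l 0) ?finNzRing_gt1.
have /FinSplittingFieldFor[L]: 'X^m - 'X != 0 :> {poly F}.
  by rewrite -size_poly_gt0 size_polyDl size_polyXn // size_polyN size_polyX.
rewrite rmorphB rmorphXn /= map_polyX => -[zs splitL _].
have [a _ frob] := finField_galois_generator (sub1v {:L}%AS).
have Uzs : uniq zs.
  by rewrite -separable_prod_XsubC -(eqp_separable splitL) separable_Xq_sub_X.
pose E := fixedField [set (a ^+ k)%g].
have frobX i z : (a ^+ i)%g z = z ^+ (#|F| ^ i).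
  elim: i => [|i IHi]; first by rewrite gal_id.
  by rewrite expgSr galM ?memvf // IHi frob ?memvf // dimv1 expn1 expnSr exprM.
have in_zs : zs =i E.
  move=> z; rewrite -root_prod_XsubC -(eqp_root splitL) /root !hornerE subr_eq0.
  rewrite -frobX; apply/eqP/(fixedFieldP (memvf z)) => [az x /set1P-> //|].
  by apply; rewrite inE.
exists (subvs_of E); rewrite dimvf /dim /=.
pose fL := FinFieldExtType L.
have : (#|F| ^ \dim E)%N = m.
  have -> : (#|F| ^ \dim E)%N = #|[pred z : fL | z \in E]| by rewrite -(@card_vspace F fL _ E).
  have /eq_card-> : [pred z : fL | z \in E] =i (zs : seq fL) by move=> z; rewrite in_zs.
  rewrite (card_uniqP (Uzs : uniq (zs : seq fL))).
  apply: succn_inj; rewrite -(size_prod_XsubC _ id) -(eqp_size splitL).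
  by rewrite size_polyDl size_polyXn // size_polyN size_polyX.
move/eqP; rewrite eqn_exp2l ?finNzRing_gt1 // => /eqP //.
Qed.

Section MultiplicationMatrices.
Import VectorInternalTheory.

Lemma exists_field_matrices (F : finFieldType) (k N : nat) :
  (k < N)%N ->
  exists T : 'I_k.+1 -> 'M[F]_N, T ord0 = 1%:M /\
    forall (t : 'I_k.+1 -> F) (y : 'rV_N),
      \sum_i t i *: (y *m T i) = 0 -> y != 0 -> forall i, t i = 0.
Proof.
move=> ltkN; have [L] := exists_field_ext F (leq_ltn_trans (leq0n k) ltkN).
rewrite dimvf => dimL; case: N / dimL ltkN => ltkN.
pose w i := (vbasis {:L})`_i.
have szw : size (vbasis {:L}) = dim L by rewrite size_tuple dimvf.
have freew : free (vbasis {:L}) := basis_free (vbasisP _).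
have w0 : w 0 != 0.
  by apply: (free_not0 freew); rewrite mem_nth // szw (leq_ltn_trans _ ltkN).
pose T (i : 'I_k.+1) := lin1_mx (fun y : 'rV_(dim L) => v2r (w i / w 0 * r2v y)).
have TE (i : 'I_k.+1) y : y *m T i = v2r (w i / w 0 * r2v y).
  pose f := fun y : 'rV_(dim L) => v2r (w i / w 0 * r2v y).
  have flin : linear f.
    by move=> a u v; rewrite /f !linearD !linearZ /= mulrDr -scalerAr linearD linearZ.
  pose fl := GRing.isLinear.Build _ _ _ _ f flin.
  pose fL : {linear _ -> _} := HB.pack f fl.
  exact: (mul_rV_lin1 fL y).
exists T; split=> [|t y].
  by apply/row_matrixP => i; rewrite !rowE TE mulmx1 divff // mul1r r2vK.
move=> sum0 y0.
have /eqP : r2v y * (w 0)^-1 * \sum_(i < k.+1) t i *: w i = 0.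
  rewrite mulr_sumr -[RHS](linear0 r2v) -sum0 linear_sum; apply: eq_bigr => i _.
  by rewrite TE linearZ /= v2rK -scalerAr -mulrA mulrC; congr (_ *: (_ * _)); rewrite mulrC.
rewrite !mulf_eq0 invr_eq0 (negPf w0) orbF.
have -> : (r2v y == 0) = false.
  by apply: contraNF y0 => /eqP e; rewrite -(r2vK y) e linear0.
move=> /eqP /=; rewrite (eq_bigr (fun i : 'I_k.+1 => t (inord i) *: w i)); last first.
  by move=> i _; rewrite inord_val.
rewrite (big_ord_widen (dim L) (fun i => t (inord i) *: w i)) // big_mkcond.
have fr : free (in_tuple (vbasis {:L})) by [].
move/freeP: fr => fr sumw i.
pose c (j : 'I_(size (vbasis {:L}))) := if (j < k.+1)%N then t (inord j) else 0.
have ilt : (i < size (vbasis {:L}))%N by rewrite szw (leq_trans (ltn_ord i)).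
have := fr c _ (Ordinal ilt); rewrite /c /= ltn_ord inord_val; apply.
rewrite -[RHS]sumw.
have E (n1 n2 : nat) (G : nat -> L) : n1 = n2 -> \sum_(j < n1) G j = \sum_(j < n2) G j.
  by move=> ->.
rewrite (E (dim L) _ (fun j => if (j < k.+1)%N then t (inord j) *: w j else 0) (esym szw)).
by apply: eq_bigr => j _; case: ifP => // _; rewrite scale0r.
Qed.

End MultiplicationMatrices.

(** * Ranks, row spaces and leading positions *)

Lemma exists_supported_matrices (F : finFieldType) (k n : nat) (J : {set 'I_n}) :
  (k < #|J|)%N ->
  exists T : 'I_k.+1 -> 'M[F]_n,
  [/\ forall i (y : 'rV_n) j, j \notin J -> (y *m T i) 0 j = 0,
      forall y : 'rV_n, (forall j, j \notin J -> y 0 j = 0) -> y *m T ord0 = y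
    & forall t (y : 'rV_n), (forall j, j \notin J -> y 0 j = 0) ->
      \sum_i t i *: (y *m T i) = 0 -> y != 0 -> forall i, t i = 0].
Proof.
move=> ltkJ; have [T [T0 indT]] := exists_field_matrices F ltkJ.
pose E : 'M[F]_(#|J|, n) := \matrix_(i, j) (enum_val i == j)%:R.
have EK (y : 'rV[F]_n) : (forall j, j \notin J -> y 0 j = 0) -> y *m E^T *m E = y.
  move=> suppy; apply/rowP => j; rewrite -mulmxA mxE.
  have EE l : (E^T *m E) l j = ((l == j) && (l \in J))%:R.
    rewrite mxE; have [lJ|lJ] := boolP (l \in J).
      rewrite (bigD1 (enum_rank_in lJ l)) //= !mxE enum_rankK_in // eqxx mul1r andbT.
      rewrite big1 ?addr0 // => i ne; rewrite !mxE.
      have [e|_] := eqVneq (enum_val i) l; last by rewrite mul0r.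
      by rewrite -(enum_valK_in lJ i) e eqxx in ne.
    rewrite andbF big1 // => i _; rewrite !mxE.
    have [e|_] := eqVneq (enum_val i) l; last by rewrite mul0r.
    by rewrite -e enum_valP in lJ.
  rewrite (bigD1 j) //= EE eqxx big1 ?addr0 => [|l]; last first.
    by rewrite EE => /negPf->; rewrite mulr0.
  by have [jJ|/suppy->] := boolP (j \in J); rewrite ?mulr1 ?mul0r.
exists (fun i => E^T *m T i *m E); split=> [i y j jJ|y|t y suppy sum0 y0].
- rewrite !mulmxA mxE big1 // => l _; rewrite [E _ _]mxE.
  by rewrite (negPf (memPn jJ _ (enum_valP l))) mulr0.
- by rewrite T0 mulmx1 mulmxA; apply: EK.
have := indT t (y *m E^T); apply; last first.
  by apply: contraNneq y0 => e; rewrite -(EK y suppy) e mul0mx.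
have EEt : E *m E^T = 1%:M.
  apply/matrixP => i j; rewrite mxE (bigD1 (enum_val i)) //= !mxE eqxx mul1r.
  rewrite big1 ?addr0 ?(inj_eq enum_val_inj) 1?eq_sym // => l; rewrite !mxE eq_sym.
  by move=> /negPf->; rewrite mul0r.
rewrite -[LHS]mulmx1 -EEt mulmxA mulmx_suml -[RHS](mul0mx _ E^T); congr (_ *m _).
by rewrite -[RHS]sum0; apply: eq_bigr => i _; rewrite -scalemxAl !mulmxA.
Qed.

Lemma rank_ge2 (F : fieldType) (k n n' : nat) (T : 'I_k -> 'M[F]_(n, n')) (D : 'M_(k, n)) :
  (forall t (y : 'rV_n), (y <= D)%MS ->
     \sum_i t i *: (y *m T i) = 0 -> y != 0 -> forall i, t i = 0) ->
  \sum_i row i D *m T i = 0 -> D != 0 -> (2 <= \rank D)%N.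
Proof.
move=> indT sum0 D0; rewrite ltnNge; apply: contra D0 => rD.
apply/rowV0P => v vD; apply/eqP/negPn/negP => v0.
have Dv : (D <= v)%MS.
  by rewrite -(geq_leqif (mxrank_leqif_sup vD)) rank_rV v0.
have /submxP[c Dc] := Dv.
have c0 : forall i, c i 0 = 0.
  apply: (indT (fun i => c i 0) v) => //.
  rewrite -[RHS]sum0; apply: eq_bigr => i _.
  rewrite Dc row_mul scalemxAl; congr (_ *m _); apply/rowP => j.
  by rewrite !mxE big_ord1 !mxE.
have D0 : D = 0.
  by apply/matrixP => i j; rewrite Dc !mxE big_ord1 c0 mul0r.
by case/submxP: vD v0 => d ->; rewrite D0 mulmx0 eqxx.
Qed.

Section RowSpace.
Variable F : finFieldType.

Lemma rowspaceP (k n : nat) (B : 'M[F]_(k, n)) (u : 'rV_n) :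
  reflect (exists c, u = c *m B) (u \in rowspace B).
Proof.
apply: (iffP idP) => [|[c ->]].
  rewrite /rowspace => /coord_span->.
  elim/big_ind: _ => [|x y [c ->] [d ->]|i _].
  - by exists 0; rewrite mul0mx.
  - by exists (c + d); rewrite mulmxDl.
  move: (coord _ i u) => a.
  have /mapP[j _ ->] : (image_tuple ((row (n:=n))^~ B) 'I_k)`_i \in [seq row j B | j : 'I_k].
    by apply/mem_nth; rewrite size_tuple ltn_ord.
  by exists (a *: delta_mx 0 j); rewrite -scalemxAl rowE.
rewrite mulmx_sum_row; apply: rpred_sum => i _; apply: rpredZ.
by apply: memv_span; apply: map_f; rewrite mem_enum.
Qed.

Lemma rowspaceE (k n : nat) (B : 'M[F]_(k, n)) :
  rowspace B = limg (linfun (mulmxr B : 'rV_k -> 'rV_n)).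
Proof.
apply/vspaceP => u; apply/rowspaceP/memv_imgP => [[c ->]|[c _ ->]].
  by exists c; rewrite ?memvf ?lfunE.
by exists c; rewrite lfunE.
Qed.

Lemma dim_rowspace_rank_ge2 (k n : nat) (B : 'M[F]_(k, n)) :
  (2 <= \rank B)%N -> (2 <= \dim (rowspace B))%N.
Proof.
rewrite !ltnNge; apply: contra => dB.
have [v vP] : exists v, (rowspace B <= <[v]>)%VS.
  exists (vpick (rowspace B)); have sv := memv_pick (rowspace B).
  rewrite memvE in sv; rewrite -(geq_leqif (dimv_leqif_sup sv)) dim_vline vpick0.
  by case: eqVneq dB => [->|_]; rewrite ?dimv0.
suff: (B <= v)%MS by move/mxrankS/leq_trans; apply; apply: rank_leq_row.
apply/row_subP => i; have : row i B \in <[v]>%VS.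
  by apply: (subvP vP); apply/rowspaceP; exists (delta_mx 0 i); rewrite rowE.
by case/vlineP => a ->; rewrite scalemx_sub.
Qed.

End RowSpace.

Section Leads.
Variable F : finFieldType.

Definition leads (n : nat) (U : {vspace 'rV[F]_n}) (A : seq nat) : Prop :=
  forall u, u \in U -> u != 0 ->
  exists j : 'I_n, [/\ (j : nat) \in A, u 0 j != 0 & forall i : 'I_n, (i < j)%N -> u 0 i = 0].

Lemma leads_cap n (U V : {vspace 'rV[F]_n}) A B :
  leads U A -> leads V B -> leads (U :&: V) [seq j <- A | j \in B].
Proof.
move=> ldU ldV u /[!memv_cap] /andP[uU uV] u0.
have [i [iA ui ltu]] := ldU u uU u0; have [j [jB uj ltv]] := ldV u uV u0.
have [lt|lt|/val_inj e] := ltngtP i j.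
- by rewrite ltv ?eqxx in ui.
- by rewrite ltu ?eqxx in uj.
by exists i; rewrite mem_filter iA e jB -e.
Qed.

Lemma leads_neq n (U : {vspace 'rV[F]_n}) A (c : 'I_n) :
  leads U A -> (forall u, u \in U -> u 0 c = 0) -> leads U [seq j <- A | j != (c : nat)].
Proof.
move=> ldU Uc u uU u0; have [j [jA uj ltu]] := ldU u uU u0; exists j; split=> //.
by rewrite mem_filter jA andbT; apply: contraNneq uj => /val_inj ->; rewrite Uc.
Qed.

Lemma leads_dim n (U : {vspace 'rV[F]_n}) A : leads U A -> (\dim U <= size A)%N.
Proof.
move=> ldU.
pose E : 'M[F]_(n, size A) := \matrix_(j, i) ((j : nat) == nth 0%N A i)%:R.
pose f := linfun (mulmxr E : 'rV_n -> 'rV_(size A)).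
have kerf : (U :&: lker f = 0)%VS.
  apply/eqP; rewrite -subv0; apply/subvP => u; rewrite memv_cap memv_ker lfunE /= memv0.
  case/andP => uU /eqP uE; apply: contraT => /(ldU u uU)[j [jA uj _]].
  case/eqP: uj; have /matrixP/(_ 0) := uE.
  have ltA : (index (j : nat) A < size A)%N by rewrite index_mem.
  move/(_ (Ordinal ltA)); rewrite !mxE (bigD1 j) //= mxE nth_index // eqxx mulr1.
  rewrite big1 ?addr0 // => i; rewrite mxE nth_index // => /negPf ne.
  by rewrite (inj_eq val_inj) ne mulr0.
rewrite -(limg_dim_eq kerf) (leq_trans (dimvS (subvf _))) // dimvf /dim /=.
by rewrite mul1n.
Qed.

Definition echelon (k n : nat) (p : 'I_k -> 'I_n) (W : 'M[F]_(k, n)) : Prop :=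
  (forall i i', W i (p i') = (i == i')%:R) /\
  (forall i (j : 'I_n), (j < p i)%N -> W i j = 0).

Lemma echelon_coef k n (p : 'I_k -> 'I_n) W (c : 'rV_k) i :
  echelon p W -> (c *m W) 0 (p i) = c 0 i.
Proof.
case=> Wp _; rewrite mxE (bigD1 i) //= Wp eqxx mulr1 big1 ?addr0 // => j.
by rewrite Wp => /negPf->; rewrite mulr0.
Qed.

Lemma echelon_leads k n (p : 'I_k -> 'I_n) W :
  {homo p : i j / (i < j)%N} -> echelon p W ->
  leads (rowspace W) [seq val (p i) | i : 'I_k].
Proof.
move=> incp eW u /rowspaceP[c ->] u0.
have /rV0Pn[i0 ci0] : c != 0 by apply: contraNneq u0 => ->; rewrite mul0mx.
case: (@arg_minnP _ i0 (fun i => c 0 i != 0) val ci0) => i ci min_i.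
exists (p i); split; first by apply: image_f.
  by rewrite echelon_coef.
move=> j ltj; rewrite mxE big1 // => l _.
have [li|le] := ltnP l i.
  by have [->|/min_i] := eqVneq (c 0 l) 0; rewrite ?mul0r // leqNgt li.
rewrite eW.2 ?mulr0 // (leq_trans ltj) //; move: le; rewrite leq_eqVlt.
by case/predU1P => [/val_inj->//|/incp/ltnW].
Qed.

Lemma echelon_dim k n (p : 'I_k -> 'I_n) (W : 'M_(k, n)) : echelon p W -> \dim (rowspace W) = k.
Proof.
move=> eW; rewrite rowspaceE limg_dim_eq ?dimvf ?/dim /= ?mul1n //.
apply/eqP; rewrite -subv0; apply/subvP => c.
rewrite memv_cap memv_ker lfunE /= memv0 => /andP[_ /eqP e].
by apply/eqP/rowP => i; rewrite -(echelon_coef c i eW) e !mxE.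
Qed.

Lemma echelon_cap k n (p : 'I_k -> 'I_n) (W W' : 'M_(k, n)) :
  echelon p W -> echelon p W' -> (2 <= \rank (W - W')%R)%N ->
  (\dim (rowspace W :&: rowspace W') <= k - 2)%N.
Proof.
move=> eW eW' /dim_rowspace_rank_ge2; rewrite rowspaceE.
set g := linfun (mulmxr (W - W')); set f := linfun (mulmxr W : 'rV_k -> 'rV_n) => r2.
have sub : (rowspace W :&: rowspace W' <= f @: lker g)%VS.
  apply/subvP => u /[!memv_cap] /andP[/rowspaceP[c uc] /rowspaceP[d ud]].
  have e : c = d.
    by apply/rowP => i; rewrite -(echelon_coef c i eW) -uc ud (echelon_coef d i eW').
  apply/memv_imgP; exists c; rewrite ?lfunE //= memv_ker lfunE /= mulmxBr -uc.
  by rewrite e -ud subrr.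
rewrite (leq_trans (dimvS sub)) // (@leq_trans (\dim (lker g))) //.
  by rewrite -(limg_ker_dim f (lker g)) leq_addl.
have := limg_ker_dim g fullv; rewrite capfv dimvf /dim /= mul1n.
by move: (\dim (lker g)) (\dim (limg g)) r2 => a b; lia.
Qed.

End Leads.

(** * Ferrers diagram, lifted MRD and two-column codes *)

(* [c] is the column of the pending dot of row 0, which is not free.  The junk
   value [c = 0] removes no dot, as a dot lies to the right of a pivot. *)
Definition dots (k n : nat) (p : 'I_k -> 'I_n) (c : nat) (i : 'I_k) : {set 'I_n} :=
  [set j : 'I_n | [&& (p i < j)%N, j \notin codom p & (j : nat) != c]].

Lemma ferrers_cell (F : finFieldType) (k n : nat) (p : 'I_k.+1 -> 'I_n) (c : nat) (t : F) :
  {homo p : i j / (i < j)%N} -> (k < #|dots p c ord0|)%N ->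
  (t != 0 -> (p ord0 < c)%N && [forall i, p i != c :> nat]) ->
  exists C : {set {vspace 'rV[F]_n}},
  [/\ #|C| = (#|F| ^ (\sum_(i < k) #|dots p c (lift ord0 i)|))%N,
      forall U, U \in C -> [/\ \dim U = k.+1, leads U [seq val (p i) | i : 'I_k.+1] &
        forall j : 'I_n, (j : nat) = c -> j \notin codom p ->
          forall u, u \in U -> u 0 j = t * u 0 (p ord0)]
    & forall U V, U \in C -> V \in C -> U != V -> (\dim (U :&: V) <= k.-1)%N].
Proof.
move=> incp ltk tP; have [T [Tsupp T0 Tind]] := exists_supported_matrices F ltk.
have injp : injective p.
  by move=> i j e; case: (ltngtP i j) => [/incp|/incp|/val_inj//]; rewrite e ltnn.
pose S := [set ij : 'I_k.+1 * 'I_n | (ij.1 != ord0) && (ij.2 \in dots p c ij.1)].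
pose words := pffun_on (0 : F) (mem S) predT.
pose Y (f : {ffun 'I_k.+1 * 'I_n -> F}) : 'M[F]_(k.+1, n) := \matrix_(i, j) f (i, j).
pose X f : 'M[F]_(k.+1, n) :=
  \matrix_(i, j) if i == ord0 then - (\sum_l row l (Y f) *m T l) 0 j else f (i, j).
pose W0 : 'M[F]_(k.+1, n) :=
  \matrix_(i, j) ((j == p i)%:R + (if (i == ord0) && ((j : nat) == c) then t else 0)).
pose W f := W0 + X f.
have dots0 i j : j \in dots p c i -> j \in dots p c ord0.
  rewrite !inE => /and3P[lt -> ->]; rewrite !andbT (leq_ltn_trans _ lt) //.
  by have [->//|i0] := eqVneq i ord0; apply/ltnW/incp; rewrite lt0n.
have wS f : f \in words -> forall i j, (i == ord0) || (j \notin dots p c i) -> f (i, j) = 0.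
  move=> /pffun_onP[/subsetP fS _] i j h; apply: contraTeq h => /fS.
  by rewrite inE /= negb_or negbK.
have XS f : f \in words -> forall i j, j \notin dots p c i -> X f i j = 0.
  move=> fw i j jD; rewrite mxE; have [e|_] := eqVneq i ord0; last by rewrite wS ?jD ?orbT.
  rewrite e in jD; rewrite summxE big1 ?oppr0 // => l _; exact: Tsupp.
have XT f : f \in words -> \sum_l row l (X f) *m T l = 0.
  move=> fw; rewrite (bigD1 ord0) //= T0; last by move=> j jD; rewrite mxE XS.
  have -> : row ord0 (X f) = - \sum_l row l (Y f) *m T l.
    by apply/rowP => j; rewrite !mxE eqxx.
  rewrite (bigD1 ord0) //= [row ord0 (Y f)](_ : _ = 0) ?mul0mx ?add0r; last first.
    by apply/rowP => j; rewrite !mxE wS ?eqxx.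
  rewrite addrC; apply/eqP; rewrite subr_eq0; apply/eqP/eq_bigr => l /negPf l0.
  by congr (_ *m _); apply/rowP => j; rewrite !mxE l0.
have pD i i' : p i' \notin dots p c i by rewrite inE codom_f andbF.
have eW f : f \in words -> echelon p (W f).
  move=> fw; split=> [i i'|i j ltj]; rewrite mxE.
    rewrite (XS f fw) // addr0 mxE (inj_eq injp) eq_sym.
    case: ifP => [/andP[_ /eqP e]|]; last by rewrite addr0.
    have [->|/tP/andP[_ /forallP/(_ i')]] := eqVneq t 0; rewrite ?addr0 // e eqxx //.
  rewrite (XS f fw) ?addr0 ?mxE; last by rewrite inE ltnNge ltnW.
  have -> : (j == p i) = false by apply/eqP => e; rewrite e ltnn in ltj.
  rewrite add0r; case: ifP => // /andP[/eqP i0 /eqP jc].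
  have [->//|/tP/andP[]] := eqVneq t 0; by rewrite -jc -i0 ltnNge ltnW.
have rkW f g : f \in words -> g \in words -> f != g -> (2 <= \rank (W f - W g)%R)%N.
  move=> fw gw fg; have -> : W f - W g = X f - X g.
    by rewrite /W opprD addrACA subrr add0r.
  apply: (@rank_ge2 _ _ _ _ T).
  - move=> s y /submxP[b yE]; apply: Tind => j jD; rewrite yE mxE big1 // => i _.
    have jDi : j \notin dots p c i by apply: contra jD; apply: dots0.
    by rewrite [(X f - X g) i j]mxE [(- X g) i j]mxE !XS // subr0 mulr0.
  - have -> : \sum_l row l (X f - X g) *m T l =
      \sum_l row l (X f) *m T l - \sum_l row l (X g) *m T l.
      by rewrite -sumrB; apply: eq_bigr => l _; rewrite linearB /= mulmxBl.
    by rewrite !XT // subrr.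
  apply: contra fg => /eqP/matrixP e; apply/eqP/ffunP => -[i j].
  have [i0|i0] := eqVneq i ord0; first by rewrite !wS // i0 eqxx.
  by have := e i j; rewrite !mxE (negPf i0) => /eqP; rewrite subr_eq0 => /eqP.
have capW f g : f \in words -> g \in words -> f != g ->
    (\dim (rowspace (W f) :&: rowspace (W g)) <= k.-1)%N.
  move=> fw gw fg; rewrite (leq_trans (echelon_cap (eW f fw) (eW g gw) (rkW f g fw gw fg))) //.
  by rewrite subSS subn1.
exists [set rowspace (W f) | f in words]; split.
- rewrite card_in_imset; last first.
    move=> f g fw gw e; apply/eqP; apply: contraT => /(capW f g fw gw).
    by rewrite e capvv (echelon_dim (eW g gw)); case: (k) => //= k'; rewrite ltnNge leqnSn.
  rewrite card_pffun_on; congr (_ ^ _)%N; rewrite -sum1_card.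
  rewrite (eq_bigl (fun ij : 'I_k.+1 * 'I_n =>
    (ij.1 != ord0) && (ij.2 \in dots p c ij.1))); last by move=> ij; rewrite inE.
  rewrite -(pair_big_dep (fun i => i != ord0) (fun i j => j \in dots p c i) (fun _ _ => 1%N)) /=.
  by rewrite big_mkcond big_ord_recl /= add0n; apply: eq_bigr => i _; rewrite sum1_card.
- move=> _ /imsetP[f fw ->]; split; [exact: echelon_dim (eW f fw)|exact: echelon_leads (eW f fw)|].
  move=> j jc jp u /rowspaceP[b ->]; rewrite (echelon_coef _ _ (eW f fw)) mxE.
  have jX i : X f i j = 0 by apply: XS => //; rewrite inE jc eqxx !andbF.
  have jpF i : (j == p i) = false by apply: contraNF jp => /eqP ->; rewrite codom_f.
  have WE i : W f i j = if i == ord0 then t else 0.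
    by rewrite mxE jX addr0 mxE jpF jc eqxx andbT add0r.
  rewrite (bigD1 ord0) //= big1 ?addr0 => [|i /negPf i0]; first by rewrite WE mulrC.
  by rewrite WE i0 mulr0.
by move=> _ _ /imsetP[f fw ->] /imsetP[g gw ->] ne; apply: capW => //; apply: contra ne => /eqP ->.
Qed.

Lemma lift_mxE (F : finFieldType) (n k : nat) (A : 'M[F]_(k, n - k)) (e : (k + (n - k))%N = n) i j :
  lift_mx A i (cast_ord e j) = row_mx 1%:M A i j.
Proof.
rewrite /lift_mx -(conform_castmx (erefl, e)) conform_mx_id castmxE /=.
by rewrite cast_ord_id cast_ordK.
Qed.

Lemma lifted_MRD (F : finFieldType) (n k : nat) : (k.+1 <= n - k.+1)%N ->
  exists D : {vspace 'M[F]_(k.+1, n - k.+1)},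
  [/\ is_MRD 2 D, #|lifted_code D| = (#|F| ^ (k * (n - k.+1)))%N,
      forall U, U \in lifted_code D -> \dim U = k.+1 /\ leads U (iota 0 k.+1)
    & forall U V, U \in lifted_code D -> V \in lifted_code D -> U != V ->
        (\dim (U :&: V) <= k.-1)%N].
Proof.
move=> ltkn; have [T [T0 Tind]] := exists_field_matrices F ltkn.
have en : (k.+1 + (n - k.+1))%N = n by lia.
pose f (A : 'M[F]_(k.+1, n - k.+1)) := \sum_i row i A *m T i.
have flin : linear f.
  move=> a A B; rewrite /f scaler_sumr -big_split; apply: eq_bigr => i _.
  by rewrite linearP /= mulmxDl scalemxAl.
pose fl := GRing.isLinear.Build _ _ _ _ f flin.
pose g : {linear _ -> _} := HB.pack f fl.
pose D := lker (linfun g).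
have DP A : (A \in D) = (f A == 0) by rewrite memv_ker lfunE.
have rkD A : A \in D -> A != 0 -> (2 <= \rank A)%N.
  by rewrite DP => /eqP A0; apply: rank_ge2 A0 => t y _; apply: Tind.
have dimD : \dim D = (k * (n - k.+1))%N.
  have := limg_ker_dim (linfun g) fullv.
  have -> : limg (linfun g) = fullv.
    apply/vspaceP => y; rewrite memvf; apply/memv_imgP.
    exists (delta_mx ord0 0 *m y); rewrite ?memvf // lfunE /= /f.
    rewrite (bigD1 ord0) //= T0 mulmx1 big1 ?addr0.
      by rewrite rowE mulmxA mul_delta_mx -{1}[y]mul1mx; congr (_ *m _);
        apply/matrixP => i j; rewrite !mxE !ord1.
    by move=> i /negPf i0; rewrite rowE mulmxA mul_delta_mx_cond i0 mulr0n !mul0mx.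
  rewrite capfv !dimvf /dim /= mul1n mulSn addnC => /addnI.
  by move=> ->.
pose p i : 'I_n := cast_ord en (lshift (n - k.+1) i).
have eL A : echelon p (lift_mx A : 'M[F]_(k.+1, n)).
  split=> [i i'|i j ltj]; first by rewrite lift_mxE row_mxEl mxE.
  have ltjk : (j < k.+1)%N by apply: leq_trans ltj _; apply: ltnW; apply: (valP i).
  have -> : j = p (Ordinal ltjk) by apply: val_inj.
  by rewrite lift_mxE row_mxEl mxE -val_eqE /= gtn_eqF.
have liftB A B : lift_mx A - lift_mx B = castmx (erefl, en) (row_mx 0 (A - B)) :> 'M[F]_(k.+1, n).
  apply/matrixP => i j; rewrite -[j](cast_ordKV en) castmxE /= cast_ord_id.
  rewrite !mxE !lift_mxE cast_ordKV !mxE.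
  by case: (split _) => j'; rewrite !mxE ?subrr.
have cap A B : A \in D -> B \in D -> A != B ->
    (\dim (rowspace (lift_mx A : 'M[F]_(k.+1, n)) :&: rowspace (lift_mx B)) <= k.-1)%N.
  move=> AD BD AB; have := echelon_cap (eL A) (eL B); rewrite subSS subn1; apply.
  have : (2 <= \rank (A - B)%R)%N by apply: rkD; rewrite ?rpredB // subr_eq0.
  rewrite liftB; move: (A - B) => C /leq_trans; apply.
  rewrite -[X in (_ <= X)%N]mxrank_tr trmx_cast eqmx_cast mxrank_tr.
  have {1}-> : C = row_mx 0 C *m col_mx (0 : 'M_(k.+1, _)) 1%:M.
    by rewrite mul_row_col mul0mx mulmx1 add0r.
  exact: mxrankM_maxl.
exists D; split.
- rewrite /is_MRD dimD; apply/andP; split.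
    by apply/eqP; rewrite (maxn_idPr _) // (minn_idPl _) // mulnC; congr (_ * _)%N; lia.
  by apply/forall_inP => A AD; apply/implyP => A0; apply: rkD.
- rewrite card_in_imset; first by rewrite card_vspace dimD.
  move=> A B AD BD e; apply/eqP; apply: contraT => /(cap A B AD BD).
  by rewrite e capvv (echelon_dim (eL B)); case: (k) => //= k'; rewrite ltnNge leqnSn.
- move=> _ /imsetP[A AD ->]; split; first exact: echelon_dim (eL A).
  have := echelon_leads _ (eL A); set s := [seq _ | i : _].
  have -> : s = iota 0 k.+1.
    by rewrite /s /image_mem -val_enum_ord; apply: eq_map.
  by apply => i j.
move=> _ _ /imsetP[A AD ->] /imsetP[B BD ->] ne; apply: cap => //; apply: contra ne => /eqP -> //.
Qed.

Lemma two_column_code (F : finFieldType) (k n : nat) : (1 < k)%N -> (k + 2 <= n)%N ->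
  exists C : {set {vspace 'rV[F]_n}},
  [/\ #|C| = (#|F| ^ k)%N, forall U, U \in C -> \dim U = k
    & forall U V, U \in C -> V \in C -> U != V -> (\dim (U :&: V) <= k - 2)%N].
Proof.
move=> k_gt1 lekn; have [T [T0 Tind]] := exists_field_matrices F k_gt1.
pose p (i : 'I_k) : 'I_n := widen_ord (leq_trans (leq_addr 2 k) lekn) i.
pose W (z : 'rV[F]_k) : 'M[F]_(k, n) := \matrix_(i, j)
  if (j < k)%N then ((i : nat) == j)%:R else
  if (j : nat) == k then z 0 i else if (j : nat) == k.+1 then (z *m T ord_max) 0 i else 0.
have eW z : echelon p (W z).
  split=> [i i'|i j ltj]; first by rewrite mxE /= ltn_ord.
  by rewrite mxE (ltn_trans ltj) //= gtn_eqF.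
have rkW y z : y != z -> (2 <= \rank (W y - W z)%R)%N.
  rewrite -subr_eq0 => yz.
  pose B : 'M[F]_(2, k) := \matrix_i (if i == ord0 then y - z else (y - z) *m T ord_max).
  pose E : 'M[F]_(n, 2) := \matrix_(j, i) ((j : nat) == k + i)%:R.
  have BE : B^T = (W y - W z) *m E.
    apply/matrixP => i l; rewrite mxE [RHS]mxE.
    have ltl : (k + l < n)%N by rewrite (leq_trans _ lekn) // ltn_add2l.
    rewrite (bigD1 (Ordinal ltl)) //= [E _ _]mxE eqxx mulr1 big1 ?addr0; last first.
      by move=> j; rewrite [E _ _]mxE -val_eqE /= => /negPf ->; rewrite mulr0.
    rewrite !mxE /= ltnNge leq_addr /=.
    case: l ltl => [[|[|//]]] ? ?; first by rewrite addn0 eqxx !mxE.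
    by rewrite addn1 eqxx gtn_eqF //= mulmxBl !mxE.
  have : (2 <= \rank B)%N.
    pose S (i : 'I_2) := if i == ord0 then T ord_max else - 1%:M.
    apply: (@rank_ge2 _ _ _ _ S).
    - move=> t x _; rewrite !big_ord_recl big_ord0 /S /= addr0 => e x0.
      pose t' (i : 'I_2) := if i == ord0 then - t (lift ord0 ord0) else t ord0.
      have t'0 : forall i, t' i = 0.
        apply: (Tind t' x) => //; rewrite !big_ord_recl big_ord0 /t' /= addr0 T0 -[RHS]e.
        rewrite mulmxN mulmx1 scalerN scaleNr addrC; congr (_ *: (_ *m T _) - _).
        exact: val_inj.
      move=> i; case: (unliftP ord0 i) => [j ->|->].
        by rewrite (ord1 j); apply/eqP; rewrite -oppr_eq0; apply/eqP/(t'0 ord0).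
      exact: (t'0 ord_max).
    - by rewrite !big_ord_recl big_ord0 /S /= !rowK /= addr0 mulmxN mulmx1 subrr.
    apply: contra yz => /eqP B0; apply/eqP.
    have := rowK (fun i : 'I_2 => if i == ord0 then y - z else (y - z) *m T ord_max) ord0.
    by rewrite -/B B0 row0.
  by move=> /leq_trans; apply; rewrite -mxrank_tr BE mxrankM_maxl.
have cap y z : y != z -> (\dim (rowspace (W y) :&: rowspace (W z)) <= k - 2)%N.
  by move=> /rkW; apply: echelon_cap.
exists [set rowspace (W z) | z in 'rV[F]_k]; split.
- rewrite card_imset ?card_mx ?mul1n // => y z e; apply/eqP; apply: contraT => /cap.
  by rewrite e capvv (echelon_dim (eW z)); lia.
- by move=> _ /imsetP[z _ ->]; apply: echelon_dim (eW z).
by move=> _ _ /imsetP[y _ ->] /imsetP[z _ ->] ne; apply: cap; apply: contra ne => /eqP ->.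
Qed.

(** * Cells and their separation *)

(* For each class [s], two triples of columns with exactly one column in common. *)
Definition head_pivots (s : nat) (b : bool) : seq nat :=
  match s with
  | 3 => if b then [:: 0; 3; 4] else [:: 0; 1; 2]
  | 4 => if b then [:: 1; 2; 4] else [:: 0; 1; 3]
  | 5 => if b then [:: 0; 2; 4] else [:: 1; 2; 3]
  | 6 => if b then [:: 2; 3; 4] else [:: 0; 1; 4]
  | _ => if b then [:: 1; 3; 4] else [:: 0; 2; 3]
  end%N.

(* Number of dots of rows 1 and 2 among the first five columns. *)
Definition head_dots (s : nat) (b : bool) : nat :=
  match s with
  | 3 => if b then 0 else 4
  | 4 => if b then 1 else 3
  | 5 => if b then 1 else 2
  | _ => if b then 0 else 2
  end%N.

Definition pivots (s : nat) (b : bool) (e : nat * nat) : seq nat :=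
  head_pivots s b ++ [:: 4 + e.1; 4 + e.2]%N.

Definition pending (F : finFieldType) (s : nat) : F :=
  if (s < 7)%N then 0 else nth 0 (enum F) (s - 7).

Lemma card_ord_count (n : nat) (P : pred nat) : #|[set j : 'I_n | P j]| = count P (iota 0 n).
Proof. by rewrite cardsE cardE size_filter -val_enum_ord count_map enumT; apply: eq_count. Qed.

Lemma count_tail2 (x y k : nat) : (4 < x)%N -> (x < y)%N -> (y < 5 + k)%N ->
  count (fun j => (j != x) && (j != y)) (iota 5 k) = (k - 2)%N.
Proof.
move=> x4 xy yk.
suff : count (fun j => (j != x) && (j != y)) (iota 5 k) = (k - (x < 5 + k) - (y < 5 + k))%N by lia.
elim: k {yk} => [|k IHk]; first by rewrite /=; lia.
by rewrite -[k.+1]addn1 iotaD count_cat IHk /= addn0; lia.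
Qed.

Lemma count_gt_neq (x y k : nat) : (4 < x)%N -> (x < y)%N -> (y < 5 + k)%N ->
  count (fun j => (x < j) && (j != y))%N (iota 5 k) = (5 + k - x - 2)%N.
Proof.
move=> x4 xy yk.
suff : count (fun j => (x < j) && (j != y))%N (iota 5 k) = (5 + k - x.+1 - (y < 5 + k))%N by lia.
elim: k {yk} => [|k IHk]; first by rewrite /=; lia.
by rewrite -[k.+1]addn1 iotaD count_cat IHk /= addn0; lia.
Qed.

Lemma count_gt (x k : nat) : (4 < x)%N ->
  count (fun j => (x < j))%N (iota 5 k) = (5 + k - x.+1)%N.
Proof.
move=> x4; elim: k => [|k IHk]; first by rewrite /=; lia.
by rewrite -[k.+1]addn1 iotaD count_cat IHk /= addn0; lia.
Qed.

Lemma head_pivotsP s b : (3 <= s)%N ->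
  [/\ size (head_pivots s b) = 3%N, sorted ltn (head_pivots s b) & all (gtn 5) (head_pivots s b)].
Proof. by move: s => [|[|[|[|[|[|[|s]]]]]]] //= _; case: b. Qed.

Lemma head_pivots_ge7 s b : (7 <= s)%N ->
  head_pivots s b = if b then [:: 1; 3; 4]%N else [:: 0; 2; 3]%N.
Proof. by move: s => [|[|[|[|[|[|[|s]]]]]]]. Qed.

Lemma count_head_dots s b (H := head_pivots s b) (c := if (s < 7)%N then 0%N else b.+1) :
  (3 <= s)%N ->
  (count (fun j => [&& nth 0 H 1 < j, j \notin H & j != c]) (iota 0 5) +
   count (fun j => [&& nth 0 H 2 < j, j \notin H & j != c]) (iota 0 5) = head_dots s b)%N.
Proof. by move: s @H @c => [|[|[|[|[|[|[|s]]]]]]] // H c _; rewrite /H /c; case: b {H c}. Qed.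

Lemma pivotsP m s b e : (3 <= s)%N -> (1 <= e.1 < e.2)%N && (e.2 <= m)%N ->
  [/\ size (pivots s b e) = 5%N, sorted ltn (pivots s b e) & all (gtn (m + 5)) (pivots s b e)].
Proof.
rewrite /pivots; move: s e => [|[|[|[|[|[|[|s]]]]]]] [x y] //= _ xy; split => //;
  by case: b => /=; lia.
Qed.

Lemma cell_exists (F : finFieldType) (m s : nat) (b : bool) (e : nat * nat) :
  (7 <= m)%N -> (3 <= s)%N -> (1 <= e.1 < e.2)%N && (e.2 <= m)%N ->
  exists C : {set {vspace 'rV[F]_(m + 5)}},
  [/\ #|C| = (#|F| ^ (2 * (m - 2) + head_dots s b + (m - e.1 - 1) + (m - e.2)))%N,
      forall U, U \in C -> [/\ \dim U = 5%N, leads U (pivots s b e) &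
        (7 <= s)%N -> forall i j : 'I_(m + 5), (i : nat) = b -> (j : nat) = b.+1 ->
          forall u, u \in U -> u 0 j = pending F s * u 0 i]
    & forall U V, U \in C -> V \in C -> U != V -> (\dim (U :&: V) <= 3)%N].
Proof.
case: e => x y /= m7 s3 /andP[/andP[x1 xy] ym].
pose A := pivots s b (x, y).
have [Asz Asorted Alt] : [/\ size A = 5%N, sorted ltn A & all (gtn (m + 5)) A].
  by apply: pivotsP => //=; rewrite x1 xy.
pose p (i : 'I_5) : 'I_(m + 5) :=
  Ordinal (all_nthP 0%N Alt i (eq_ind_r (fun k => i < k)%N (ltn_ord i) Asz)).
have incp : {homo p : i j / (i < j)%N}.
  move=> i j /= ij; rewrite (sorted_ltn_nth ltn_trans) ?inE ?Asz //.
have valp : [seq val (p i) | i : 'I_5] = A.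
  by rewrite -[RHS](mkseq_nth 0%N) Asz /mkseq -val_enum_ord -map_comp; apply: eq_map.
pose c : nat := if (s < 7)%N then 0%N else b.+1.
have codomp (j : 'I_(m + 5)) : (j \in codom p) = ((j : nat) \in A).
  rewrite -valp; apply/codomP/imageP => [[i ->]|[i _ e]]; first by exists i.
  by exists i; apply: val_inj.
pose P i j := [&& nth 0 A i < j, j \notin A & j != c]%N.
have cdots i : #|dots p c i| = (count (P i) (iota 0 5) + count (P i) (iota 5 m))%N.
  rewrite -count_cat -iotaD [(5 + m)%N]addnC -card_ord_count; congr #|pred_of_set _|.
  by apply/setP => j; rewrite !inE codomp.
have A5 i : (i < 3)%N -> (nth 0%N A i < 5)%N.
  by rewrite /A /pivots; move: (head_pivotsP b s3) => [sz _ /all_nthP h] i3;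
    rewrite nth_cat sz i3; apply: h; rewrite sz.
have c5 : (c < 5)%N by rewrite /c; case: ifP => // _; case: (b).
have A_tail j : (4 < j)%N -> (j \in A) = (j == 4 + x)%N || (j == 4 + y)%N.
  move=> j5; rewrite mem_cat !inE; case: (boolP (j \in head_pivots s b)) => // jh.
  by have [_ _ /allP/(_ j jh)] := head_pivotsP b s3; rewrite /= ltnNge j5.
have tail_lo i : (i < 3)%N ->
    count (P i) (iota 5 m) = (m - 2)%N.
  move=> i3; rewrite -(@count_tail2 (4 + x) (4 + y) m); try lia.
  apply: eq_in_count => j; rewrite /P ?nthA3 ?nthA4 mem_iota => /andP[j5 _].
  rewrite (leq_trans (A5 i i3)) // A_tail // negb_or.
  by have -> : j != c; [lia|rewrite andbT].
have nthA3 : nth 0%N A 3 = (4 + x)%N.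
  by rewrite /A /pivots; have [sz _ _] := head_pivotsP b s3; rewrite nth_cat sz.
have nthA4 : nth 0%N A 4 = (4 + y)%N.
  by rewrite /A /pivots; have [sz _ _] := head_pivotsP b s3; rewrite nth_cat sz.
have tail3 : count (P 3) (iota 5 m) = (m - x - 1)%N.
  rewrite -[RHS](_ : (5 + m - (4 + x) - 2) = _)%N; last lia.
  rewrite -(@count_gt_neq (4 + x) (4 + y) m); try lia.
  apply: eq_in_count => j; rewrite /P ?nthA3 ?nthA4 mem_iota => /andP[j5 _]; rewrite A_tail //; lia.
have tail4 : count (P 4) (iota 5 m) = (m - y)%N.
  rewrite -[RHS](_ : (5 + m - (4 + y).+1) = _)%N; last lia.
  rewrite -count_gt; last lia.
  apply: eq_in_count => j; rewrite /P ?nthA3 ?nthA4 mem_iota => /andP[j5 _]; rewrite A_tail //; lia.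
have head34 i : (4 < nth 0%N A i)%N ->
    count (P i) (iota 0 5) = 0%N.
  move=> hi; rewrite -(count_pred0 (iota 0 5)); apply: eq_in_count => j.
  rewrite mem_iota /P /= => j5.
  by have -> : (nth 0%N A i < j)%N = false by lia.
have head12 : (count (P 1) (iota 0 5)
    + count (P 2) (iota 0 5) = head_dots s b)%N.
  have headE i : (i < 3)%N -> count (P i) (iota 0 5) = count (fun j =>
      [&& nth 0 (head_pivots s b) i < j, j \notin head_pivots s b & j != c])%N (iota 0 5).
    have [sz _ _] := head_pivotsP b s3.
    move=> i3; apply: eq_in_count => j; rewrite mem_iota /P /A /pivots nth_cat sz i3 => /= j5.
    rewrite mem_cat !inE [(j == _)](_ : _ = false); last lia.
    by rewrite [(j == (4 + y)%N)](_ : _ = false) ?orbF //; lia.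
  rewrite !headE //.
  exact: count_head_dots.
have cA : (6 < s)%N -> c \notin A.
  move=> s7; rewrite mem_cat head_pivots_ge7 // /c ltnNge s7 /= !inE; case: (b) => /=; lia.
have tP : pending F s != 0 -> (p ord0 < c)%N && [forall i, p i != c :> nat].
  rewrite /pending /c; case: ltnP => [_ /eqP//|s7 _].
  move: (cA s7); rewrite /c ltnNge s7 /= => {}cA.
  apply/andP; split; first by rewrite /A /pivots (head_pivots_ge7 b s7); case: (b).
  by apply/forallP => i; apply: (memPn cA); rewrite mem_nth ?Asz.
have [|C [cardC CP Ccap]] := @ferrers_cell F 4 (m + 5) p c (pending F s) incp _ tP.
  by rewrite cdots tail_lo //; lia.
exists C; split => //.
  rewrite cardC; congr (_ ^ _)%N; under eq_bigr do rewrite cdots lift0.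
  rewrite -(big_mkord xpredT (fun i => count (P i.+1) (iota 0 5) + count (P i.+1) (iota 5 m)))%N.
  rewrite -[index_iota 0 4]/[:: 0; 1; 2; 3]%N !big_cons big_nil.
  rewrite (tail_lo 1) // (tail_lo 2) // tail3 tail4.
  rewrite (head34 3) ?(head34 4) ?nthA3 ?nthA4; [|lia..].
  rewrite -head12; lia.
move=> U UC; have [dU lU pU] := CP U UC; split => //; first by rewrite valp in lU.
move=> s7 i j ib jb u uU.
have jc : (j : nat) = c by rewrite jb /c ltnNge s7.
have -> : i = p ord0.
  by apply: val_inj; rewrite /= ib /A /pivots head_pivots_ge7 //; case: (b).
by apply: pU; rewrite ?codomp ?jc ?cA.
Qed.

Section Unions.
Variables (F : finFieldType) (n : nat).
Implicit Types (C : {set {vspace 'rV[F]_n}}).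

Definition separated C C' : Prop :=
  forall U V, U \in C -> V \in C' -> (\dim (U :&: V) <= 3)%N.

Definition good_code C : Prop :=
  (forall U, U \in C -> \dim U = 5%N) /\
  (forall U V, U \in C -> V \in C -> U != V -> (\dim (U :&: V) <= 3)%N).

Lemma good_codeU C C' : good_code C -> good_code C' -> separated C C' ->
  good_code (C :|: C') /\ #|C :|: C'| = (#|C| + #|C'|)%N.
Proof.
move=> [dC cC] [dC' cC'] sep; split; first split.
- by move=> U /setUP[/dC|/dC'].
- move=> U V /setUP[UC|UC] /setUP[VC|VC]; [exact: cC|move=> _; exact: sep| |exact: cC'].
  by move=> _; rewrite capvC; apply: sep.
rewrite cardsU (_ : C :&: C' = set0) ?cards0 ?subn0 //.
apply/setP => U; rewrite !inE; apply/andP => -[UC UC'].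
by have := sep U U UC UC'; rewrite capvv dC.
Qed.

Lemma good_code_union (I : eqType) (r : seq I) (w : I -> nat)
    (P : I -> {vspace 'rV[F]_n} -> Prop) :
  uniq r ->
  (forall i, i \in r -> exists C, [/\ good_code C, #|C| = w i & forall U, U \in C -> P i U]) ->
  (forall i j U V, i \in r -> j \in r -> i != j -> P i U -> P j V -> (\dim (U :&: V) <= 3)%N) ->
  exists C, [/\ good_code C, #|C| = (\sum_(i <- r) w i)%N &
    forall U, U \in C -> exists2 i, i \in r & P i U].
Proof.
elim: r => [|i r IHr] /=.
  move=> _ _ _; exists set0; rewrite big_nil cards0; split=> [||U]; rewrite ?inE //.
  by split=> [U|U V]; rewrite inE.
case/andP=> ir ur exC sep.
have [||C [gC cC PC]] := IHr ur.
- by move=> j jr; apply: exC; rewrite inE jr orbT.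
- by move=> j k U V jr kr; apply: sep; rewrite inE ?jr ?kr orbT.
have [Ci [gCi cCi PCi]] := exC i (mem_head _ _).
have [|gU cU] := good_codeU gCi gC.
  move=> U V /PCi PU /PC[j jr PV]; apply: (sep i j) PU PV; rewrite ?mem_head ?inE ?jr ?orbT //.
  by apply: contraNneq ir => ->.
exists (Ci :|: C); split=> //; first by rewrite cU cCi cC big_cons.
move=> U /setUP[/PCi PU|/PC[j jr PU]]; first by exists i; rewrite ?mem_head.
by exists j; rewrite // inE jr orbT.
Qed.

End Unions.

(* Pairs of class [s], where 2 h + 1 is the largest odd number not above [m].  The
   last alternative is 2 e.1 = s mod 2 h + 1 for the largest class s = 2 h + 3. *)
Definition edge (h m s : nat) (e : nat * nat) : bool :=
  ((1 <= e.1 < e.2) && (e.2 <= m) &&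
  ((e.2 <= 2 * h + 1) && ((e.1 + e.2 == s) || (e.1 + e.2 == s + 2 * h + 1)) ||
   (2 * h + 1 < e.2) && [|| 2 * e.1 == s, 2 * e.1 == s + 2 * h + 1
                          | (s == 2 * h + 3) && (e.1 == 1)]))%N.

Lemma edge_disjoint h m s e e' : (m <= 2 * h + 2)%N -> (3 <= s <= 2 * h + 3)%N ->
  edge h m s e -> edge h m s e' -> e != e' ->
  [/\ e.1 != e'.1, e.1 != e'.2, e.2 != e'.1 & e.2 != e'.2].
Proof.
case: e e' => [a b] [a' b']; rewrite /edge xpair_eqE /= => mh sh E E' ne.
by split; lia.
Qed.

Lemma edge_neq h m s s' e e' : (m <= 2 * h + 2)%N -> (3 <= s <= m + 1)%N -> (3 <= s' <= m + 1)%N ->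
  (2 * h + 1 <= m)%N ->
  edge h m s e -> edge h m s' e' -> s != s' -> e != e'.
Proof.
case: e e' => [a b] [a' b']; rewrite /edge xpair_eqE /= => mh sh sh' hm E E' ne.
lia.
Qed.

Definition tail_pivots (e : nat * nat) : seq nat := [:: 4 + e.1; 4 + e.2]%N.

Lemma size_pivots_meet s s' b b' e e' :
  (3 <= s)%N -> (3 <= s')%N -> (1 <= e.1 < e.2)%N -> (1 <= e'.1 < e'.2)%N ->
  size [seq j <- pivots s b e | j \in pivots s' b' e'] =
  (size [seq j <- head_pivots s b | j \in head_pivots s' b'] +
   size [seq j <- tail_pivots e | j \in tail_pivots e'])%N.
Proof.
move=> s3 s3' e1 e1'; rewrite /pivots filter_cat size_cat; congr (_ + _)%N.
  congr size; apply: eq_in_filter => j jh; rewrite mem_cat.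
  have [_ _ /allP/(_ j jh) /= j5] := head_pivotsP b s3.
  by rewrite !inE; case: (_ \in _) => //=; lia.
congr size; apply: eq_in_filter => j jt; rewrite mem_cat.
case: (boolP (j \in head_pivots s' b')) => // jh.
have [_ _ /allP/(_ j jh) /= j5] := head_pivotsP b' s3'.
move: jt; rewrite !inE; lia.
Qed.

Lemma tail_meet e e' : (e.1 < e.2)%N -> (e'.1 < e'.2)%N -> e != e' ->
  (size [seq j <- tail_pivots e | j \in tail_pivots e'] <= 1)%N.
Proof.
case: e e' => [a b] [a' b']; rewrite /tail_pivots xpair_eqE /= !inE => h h' ne.
by do 2 case: ifP => /=; lia.
Qed.

Lemma head_meet_same s b b' : (3 <= s)%N -> b != b' ->
  (size [seq j <- head_pivots s b | j \in head_pivots s b'] <= 1)%N.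
Proof. by move: s => [|[|[|[|[|[|[|s]]]]]]] // _; case: b; case: b'. Qed.

Lemma head_meet_neq s s' b b' : (3 <= s)%N -> (3 <= s')%N -> s != s' ->
  ~~ [&& 6 < s, 6 < s' & b == b']%N ->
  (size [seq j <- head_pivots s b | j \in head_pivots s' b'] <= 2)%N.
Proof.
move: s s' => [|[|[|[|[|[|[|s]]]]]]] [|[|[|[|[|[|[|s']]]]]]] // _ _ ne; case: b; case: b' => //.
Qed.

Definition cell_prop (F : finFieldType) (m s : nat) (b : bool) (e : nat * nat)
    (U : {vspace 'rV[F]_(m + 5)}) : Prop :=
  leads U (pivots s b e) /\
  ((7 <= s)%N -> forall i j : 'I_(m + 5), (i : nat) = b -> (j : nat) = b.+1 ->
     forall u, u \in U -> u 0 j = pending F s * u 0 i).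

(* In the intersection the coordinate [b.+1] is two different multiples of the
   coordinate [b], so the latter vanishes and [b] is not a leading position. *)
Lemma cell_sep_pending (F : finFieldType) (m s s' : nat) b e e' (U V : {vspace 'rV[F]_(m + 5)}) :
  (7 <= s <= #|F| + 6)%N -> (7 <= s' <= #|F| + 6)%N -> s != s' ->
  (1 <= e.1 < e.2)%N -> (1 <= e'.1 < e'.2)%N -> e != e' ->
  cell_prop s b e U -> cell_prop s' b e' V -> (\dim (U :&: V) <= 3)%N.
Proof.
move=> /andP[s7 sq] /andP[s7' sq'] ne e1 e1' nee [lU pU] [lV pV].
have b5 : (b < m + 5)%N by case: (b); rewrite addnC.
have b6 : (b.+1 < m + 5)%N by case: (b); rewrite addnC.
have UV0 u : u \in (U :&: V)%VS -> u 0 (Ordinal b5) = 0.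
  rewrite memv_cap => /andP[uU uV]; apply/eqP; move: ne; apply: contraR => u0.
  have := pU s7 (Ordinal b5) (Ordinal b6) erefl erefl u uU.
  rewrite (pV s7' (Ordinal b5) (Ordinal b6) erefl erefl u uV) => /(mulIf u0) /eqP.
  rewrite /pending (ltnNge s 7) (ltnNge s' 7) s7 s7' /=.
  have ltq r : (7 <= r <= #|F| + 6)%N -> (r - 7 < size (enum F))%N.
    by rewrite -cardE => /andP[r7 rq]; rewrite ltn_subLR // addnC -ltnS -addnS in rq *.
  rewrite nth_uniq ?enum_uniq ?ltq ?s7 ?s7' //; lia.
have s3 : (3 <= s)%N by lia.
have s3' : (3 <= s')%N by lia.
apply: leq_trans (leads_dim (leads_neq (leads_cap lU lV) UV0)) _.
rewrite -filter_predI.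
have -> : [seq j <- pivots s b e |
      predI (fun j => j != Ordinal b5 :> nat) (fun j => j \in pivots s' b e') j] =
    [seq j <- [seq j <- pivots s b e | j \in pivots s' b e'] | j != b :> nat].
  by rewrite -filter_predI.
have sz := size_pivots_meet b b s3 s3' e1 e1'.
have tm : (size [seq j <- tail_pivots e | j \in tail_pivots e'] <= 1)%N.
  by apply: tail_meet => //; lia.
have bin : (b : nat) \in [seq j <- pivots s b e | j \in pivots s' b e'].
  by rewrite mem_filter !mem_cat !head_pivots_ge7 //; case: (b).
rewrite size_filter.
have := count_predC (fun j => j != b :> nat) [seq j <- pivots s b e | j \in pivots s' b e'].
rewrite sz !head_pivots_ge7 //.
have -> : size [seq j <- if b then [:: 1; 3; 4]%N else [:: 0; 2; 3]%N
     | j \in if b then [:: 1; 3; 4]%N else [:: 0; 2; 3]%N] = 3%N by case: (b).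
have : (0 < count (predC (fun j => j != b :> nat))
    [seq j <- pivots s b e | j \in pivots s' b e'])%N.
  by rewrite -has_count; apply/hasP; exists (b : nat); rewrite //= eqxx.
lia.
Qed.

Lemma cell_sep (F : finFieldType) (h m : nat) (i i' : nat * bool * (nat * nat))
    (U V : {vspace 'rV[F]_(m + 5)}) :
  (2 * h + 1 <= m <= 2 * h + 2)%N ->
  (3 <= i.1.1 <= minn (#|F| + 6) (m + 1))%N -> (3 <= i'.1.1 <= minn (#|F| + 6) (m + 1))%N ->
  edge h m i.1.1 i.2 -> edge h m i'.1.1 i'.2 -> i != i' ->
  cell_prop i.1.1 i.1.2 i.2 U -> cell_prop i'.1.1 i'.1.2 i'.2 V -> (\dim (U :&: V) <= 3)%N.
Proof.
case: i i' => [[s b] e] [[s' b'] e'] /= hm sr sr' E E' ne cU cV.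
have [lU _] := cU; have [lV _] := cV.
have s3 : (3 <= s)%N by lia.
have s3' : (3 <= s')%N by lia.
have e1 : (1 <= e.1 < e.2)%N by move: E; rewrite /edge; lia.
have e1' : (1 <= e'.1 < e'.2)%N by move: E'; rewrite /edge; lia.
have lUV := leads_dim (leads_cap lU lV).
rewrite size_pivots_meet // in lUV.
have [ss|ss] := eqVneq s s'; last first.
  have nee : e != e' by apply: (edge_neq _ _ _ _ E E') => //; lia.
  have [/and3P[s7 s7' /eqP bb]|nn] := boolP [&& 6 < s, 6 < s' & b == b']%N.
    rewrite -bb in cV; move: sr sr'; rewrite !leq_min => /and3P[_ sq _] /and3P[_ sq' _].
    by apply: (cell_sep_pending _ _ ss e1 e1' nee cU cV); rewrite ?s7 ?s7'.
  have hmt := head_meet_neq s3 s3' ss nn.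
  have tm : (size [seq j <- tail_pivots e | j \in tail_pivots e'] <= 1)%N.
    by apply: tail_meet => //; lia.
  exact: leq_trans lUV (leq_add hmt tm).
move: ss E' sr' lUV ne {cV lV s3'} => <- E' sr' lUV; rewrite !xpair_eqE eqxx /= => ne.
have [bb|bb] := eqVneq b b'; last first.
  apply: leq_trans lUV (leq_add (head_meet_same s3 bb) _).
  by rewrite size_filter (leq_trans (count_size _ _)).
rewrite bb eqxx /= in ne.
have [||n1 n2 n3 n4] := edge_disjoint _ _ E E' ne; try lia.
have -> : (\dim (U :&: V) <= 3)%N = (\dim (U :&: V) <= 3 + 0)%N by [].
apply: leq_trans lUV _; apply: leq_add.
  rewrite size_filter (leq_trans (count_size _ _)) //.
  by have [-> _ _] := head_pivotsP b s3.
rewrite /tail_pivots /= !inE; do 2 case: ifP => /=; lia.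
Qed.

Lemma embed_code (F : finFieldType) (m k : nat) (C0 : {set {vspace 'rV[F]_m}}) :
  good_code C0 ->
  exists C : {set {vspace 'rV[F]_(m + k)}},
  [/\ good_code C, #|C| = #|C0| & forall U, U \in C -> leads U (iota k m)].
Proof.
move=> [dC cC].
pose E : 'M[F]_(m, m + k) := \matrix_(i, j) ((j : nat) == i + k)%N%:R.
pose f := linfun (mulmxr E : 'rV_m -> 'rV_(m + k)).
have lt_ik (i : 'I_m) : (i + k < m + k)%N by rewrite ltn_add2r.
have fE u (j : 'I_(m + k)) (i : 'I_m) : (j : nat) = (i + k)%N -> f u 0 j = u 0 i.
  move=> ji; rewrite lfunE /= mxE (bigD1 i) //= mxE ji eqxx mulr1 big1 ?addr0 // => l.
  by rewrite mxE ji eqn_add2r eq_sym => /negPf li; rewrite val_eqE li mulr0.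
have kerf : lker f == 0%VS.
  rewrite -subv0; apply/subvP => u; rewrite memv_ker memv0 => /eqP u0.
  by apply/eqP/rowP => i; rewrite -(fE u (Ordinal (lt_ik i)) i) // u0 !mxE.
have capf U V : (f @: U :&: f @: V = f @: (U :&: V))%VS by rewrite lker0_img_cap.
have dimf U : \dim (f @: U) = \dim U by apply: limg_dim_eq; rewrite (eqP kerf) capv0.
exists [set (f @: U)%VS | U in C0]; split; first split.
- by move=> _ /imsetP[U UC ->]; rewrite dimf dC.
- move=> _ _ /imsetP[U UC ->] /imsetP[V VC ->] ne; rewrite capf dimf; apply: cC => //.
  by apply: contraNneq ne => ->.
- rewrite card_in_imset // => U V UC VC e; apply/eqP/contraT => /(cC U V UC VC).
  by rewrite -dimf -capf e capvv dimf dC.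
move=> _ /imsetP[U UC ->] u /memv_imgP[v vU ->] fv0.
have /rV0Pn[i0 vi0] : v != 0 by apply: contraNneq fv0 => ->; rewrite linear0.
case: (@arg_minnP _ i0 (fun i => v 0 i != 0) val vi0) => i vi min_i.
exists (Ordinal (lt_ik i)); rewrite (fE _ _ i) //; split => //.
  by rewrite mem_iota /=; have := ltn_ord i; lia.
move=> j /= ltj; have [lejk|ltjk] := leqP k j; last first.
  rewrite lfunE /= mxE big1 // => l _; rewrite mxE [_ == _](_ : _ = false) ?mulr0 //.
  by apply/eqP; lia.
have jm : (j - k < m)%N by have := ltn_ord j; lia.
rewrite (fE v j (Ordinal jm)) /=; last lia.
by apply/eqP; apply: contraT => /min_i /=; lia.
Qed.

Lemma tail_pivots_ge e j : (1 <= e.1 < e.2)%N -> j \in [:: 4 + e.1; 4 + e.2]%N -> (4 < j)%N.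
Proof. by rewrite !inE; lia. Qed.

Lemma level_code (F : finFieldType) (h m : nat) (sl : seq nat) (el : nat -> seq (nat * nat))
    (C0 : {set {vspace 'rV[F]_m}}) :
  (7 <= m)%N -> (2 * h + 1 <= m <= 2 * h + 2)%N -> uniq sl ->
  (forall s, s \in sl -> 3 <= s <= minn (#|F| + 6) (m + 1))%N ->
  (forall s, s \in sl -> uniq (el s)) ->
  (forall s e, s \in sl -> e \in el s -> edge h m s e) ->
  good_code C0 ->
  exists C : {set {vspace 'rV[F]_(m + 5)}},
  [/\ good_code C,
      exists D : {vspace 'M[F]_(5, m + 5 - 5)}, is_MRD 2 D /\ lifted_code D \subset C
    & #|C| = (#|F| ^ (4 * m) + \sum_(s <- sl) \sum_(b <- [:: false; true]) \sum_(e <- el s)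
         #|F| ^ (2 * (m - 2) + head_dots s b + (m - e.1 - 1) + (m - e.2)) + #|C0|)%N].
Proof.
move=> m7 hm usl slP uel elP gC0.
pose r := [seq (sb, e) | sb <- [seq (s, b) | s <- sl, b <- [:: false; true]], e <- el sb.1].
pose w (i : nat * bool * (nat * nat)) :=
  (#|F| ^ (2 * (m - 2) + head_dots i.1.1 i.1.2 + (m - i.2.1 - 1) + (m - i.2.2)))%N.
have rP i : i \in r -> (i.1.1 \in sl) && (i.2 \in el i.1.1).
  case/allpairsPdep=> [[s b]] [e] [/allpairsP[[s' b'] [/= ss _ [-> ->]]] /= ee ->] /=.
  by rewrite ss.
have ur : uniq r.
  apply: allpairs_uniq_dep.
  - by apply: allpairs_uniq => // -[s b] [s' b'] _ _ [-> ->].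
  - by move=> [s b] /allpairsP[[s' b'] [/= ss _ [-> _]]]; apply: uel.
  - by move=> [[s b] e] [[s' b'] e'] _ _ /= [-> -> ->].
pose P i U := @cell_prop F m i.1.1 i.1.2 i.2 U.
have [||C1 [gC1 cC1 PC1]] := @good_code_union F (m + 5) _ r w P ur.
- move=> i /rP/andP[si ei]; have si3 := slP _ si; have edg := elP _ _ si ei.
  have [||C [cC PC capC]] := @cell_exists F m i.1.1 i.1.2 i.2 m7; first by case/andP: si3.
    by move: edg; rewrite /edge; lia.
  exists C; split => //; first by split=> // U /PC[].
  by move=> U /PC[].
- move=> i j U V /rP/andP[si ei] /rP/andP[sj ej] ij.
  by apply: (@cell_sep F h m i j U V) => //; auto.
have [|D [mrdD cD PD capD]] := @lifted_MRD F (m + 5) 4; first lia.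
have [C2 [gC2 cC2 PC2]] := embed_code 5 gC0.
have gD : good_code (lifted_code D) by split=> // U /PD[].
have piv i : i \in r -> (3 <= i.1.1)%N /\ (1 <= i.2.1 < i.2.2)%N.
  move=> /rP/andP[si ei]; have /andP[i3 _] := slP _ si; split=> //.
  by case/andP: (elP _ _ si ei) => /andP[].
have [|gU cU] := good_codeU gC1 gC2.
  move=> U V /PC1[i /piv[i3 ei] [lU _]] /PC2 lV.
  apply: leq_trans (leads_dim (leads_cap lU lV)) _.
  rewrite /pivots filter_cat size_cat; have [sz _ /allP hp] := head_pivotsP i.1.2 i3.
  rewrite (eq_in_filter (a2 := pred0)) ?filter_pred0 => [|j /hp /=]; last by rewrite mem_iota; lia.
  by rewrite size_filter (leq_trans (count_size _ _)).
have [|gA cA] := good_codeU gD gU.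
  move=> U V /PD[_ lU] /setUP[/PC1[i /piv[i3 ei] [lV _]]|/PC2 lV].
    rewrite capvC; apply: leq_trans (leads_dim (leads_cap lV lU)) _.
    rewrite /pivots filter_cat size_cat; have [sz _ _] := head_pivotsP i.1.2 i3.
    rewrite -[X in (_ <= X)%N]/(3 + 0)%N leq_add // ?size_filter.
      by rewrite -[X in (_ <= X)%N]sz count_size.
    rewrite (eq_in_count (a2 := pred0)) ?count_pred0 // => j.
    by move=> /(tail_pivots_ge ei) j5; rewrite mem_iota /= ltnNge j5.
  apply: leq_trans (leads_dim (leads_cap lU lV)) _.
  rewrite (eq_in_filter (a2 := pred0)) ?filter_pred0 // => j; rewrite !mem_iota /=; lia.
exists (lifted_code D :|: (C1 :|: C2)); split => //.
  by exists D; rewrite subsetUl.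
rewrite cA cU cD cC1 cC2 addnA addnK; congr (_ + _ + _)%N.
by rewrite /r !big_allpairs_dep; apply: eq_bigr.
Qed.

(** * Counting *)

Definition edges (h m s : nat) : seq (nat * nat) :=
  ([seq (a, s - a) | a <- iota 1 (s.-1)./2] ++
   [seq (s + a, 2 * h + 1 - a) | a <- iota 0 (h - (s.-1)./2)] ++
   (if (m == 2 * h + 2) && (s <= 2 * h + 2) then
      [:: (if odd s then (s + 2 * h + 1)./2 else s./2, m)] else [::]))%N.

Lemma edgesP h m s e : (2 * h + 1 <= m <= 2 * h + 2)%N -> (3 <= s <= m + 1)%N ->
  e \in edges h m s -> edge h m s e.
Proof.
move=> hm sm; have os := odd_double_half s.
have i2 : (s = 2 * (s.-1)./2 + 1 \/ s = 2 * (s.-1)./2 + 2)%N by lia.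
rewrite !mem_cat => /or3P[/mapP[a]|/mapP[a]|]; rewrite ?mem_iota.
- by move: i2; set i := (s.-1)./2 => i2 ai -> /=; rewrite /edge /=; lia.
- by move: i2; set i := (s.-1)./2 => i2 ai -> /=; rewrite /edge /=; lia.
case: ifP => // /andP[/eqP mh sh]; rewrite inE => /eqP -> /=; rewrite /edge /=.
case: ifP => odds; first by rewrite odds in os; have := odd_double_half (s + 2 * h + 1); lia.
by rewrite odds in os; lia.
Qed.

Lemma edges_uniq h m s : (2 * h + 1 <= m <= 2 * h + 2)%N -> (3 <= s <= m + 1)%N ->
  uniq (edges h m s).
Proof.
move=> hm sm.
have i2 : (s = 2 * (s.-1)./2 + 1 \/ s = 2 * (s.-1)./2 + 2)%N by lia.
have u1 : uniq [seq (a, s - a)%N | a <- iota 1 (s.-1)./2].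
  by rewrite map_inj_uniq ?iota_uniq // => a b [].
have u2 : uniq [seq (s + a, 2 * h + 1 - a)%N | a <- iota 0 (h - (s.-1)./2)].
  by rewrite map_inj_uniq ?iota_uniq // => a b [] /addnI.
rewrite !cat_uniq u1 u2 /=.
apply/andP; split.
  apply/hasPn => x; rewrite mem_cat => xx; apply/negP => /mapP[a]; rewrite mem_iota => ai xE.
  move: xx; rewrite {}xE; case/orP => [/mapP[b]|].
    by rewrite mem_iota => bi [e1 e2]; move: i2 ai bi e1 e2; set i := (s.-1)./2; lia.
  case: ifP => // mh; rewrite inE xpair_eqE => /andP[_ /eqP]; lia.
apply/andP; split; last by case: ifP.
apply/hasPn => x; case: ifP => // mh; rewrite inE => /eqP -> /=.
by apply/negP => /mapP[a] _ [_]; lia.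
Qed.

Definition edge_sum (q h m s : nat) : nat :=
  (\sum_(e <- edges h m s) q ^ ((m - e.1 - 1) + (m - e.2)))%N.

Lemma edge_sumE q h m s : (2 * h + 1 <= m <= 2 * h + 2)%N -> (3 <= s <= m + 1)%N ->
  edge_sum q h m s =
  ((s.-1)./2 * q ^ (2 * m - 1 - s) + (h - (s.-1)./2) * q ^ (2 * m - 2 * h - 2 - s) +
  (if (m == 2 * h + 2) && (s <= 2 * h + 2) then
     q ^ (m - (if odd s then (s + 2 * h + 1)./2 else s./2) - 1) else 0))%N.
Proof.
move=> hm sm.
have i2 : (s = 2 * (s.-1)./2 + 1 \/ s = 2 * (s.-1)./2 + 2)%N by lia.
rewrite /edge_sum !big_cat /= addnA !big_map; congr (_ + _ + _)%N.
- rewrite (eq_big_seq (fun=> q ^ (2 * m - 1 - s)))%N; last first.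
    by move=> a; rewrite mem_iota /= => ai; congr (_ ^ _)%N; lia.
  by rewrite big_const_seq count_predT size_iota iter_addn_0 mulnC.
- rewrite (eq_big_seq (fun=> q ^ (2 * m - 2 * h - 2 - s)))%N; last first.
    by move=> a; rewrite mem_iota /= => ai; congr (_ ^ _)%N; lia.
  by rewrite big_const_seq count_predT size_iota iter_addn_0 mulnC.
case: ifP => _; last by rewrite big_nil.
by rewrite big_cons big_nil addn0 /= subnn addn0 subnAC.
Qed.

Lemma powzE (q k : nat) (z : int) : z = k%:Z -> (q%:R : rat) ^ z = (q ^ k)%N%:R.
Proof. by move->; rewrite -exprnP natrX. Qed.

Section EdgeSumFormulas.
Variables (q h : nat).
Local Notation Q := (q%:R : rat).

Lemma half_pred_odd i : ((2 * i + 1).-1)./2 = i.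
Proof. by rewrite addn1 /= mul2n doubleK. Qed.

Lemma half_pred_even i : ((2 * i + 2).-1)./2 = i.
Proof. by rewrite addn2 /= mul2n uphalf_double. Qed.

Lemma edge_sum_even_x_odd (x i : nat) (e : int) : x = (2 * h + 6)%N -> e = x%:Z ->
  (1 <= i <= h)%N ->
  (edge_sum q h (x - 5) (2 * i + 1))%:R =
  i%:R * Q ^ (2 * e - 2 * i%:Z - 12) + ((x%:R - 6) / 2 - i%:R) * Q ^ (e - 2 * i%:Z - 7).
Proof.
move=> xh ex ih; rewrite edge_sumE; [|lia..].
rewrite half_pred_odd ifN ?addn0; last by apply/negP; lia.
rewrite natrD !natrM; congr (_ * _ + _).
  by rewrite (@powzE _ (2 * (x - 5) - 1 - (2 * i + 1))) //; lia.
have -> : (x%:R - 6) / 2 - i%:R = (h - i)%N%:R :> rat.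
  by rewrite xh natrB; [rewrite natrD natrM; field|lia].
have [->|hi] := eqVneq (h - i)%N 0%N; first by rewrite !mul0r.
by congr (_ * _); rewrite (@powzE _ (2 * (x - 5) - 2 * h - 2 - (2 * i + 1))) //; lia.
Qed.

Lemma edge_sum_even_x_even (x i : nat) (e : int) : x = (2 * h + 6)%N -> e = x%:Z ->
  (1 <= i <= h)%N ->
  (edge_sum q h (x - 5) (2 * i + 2))%:R =
  i%:R * Q ^ (2 * e - 2 * i%:Z - 13) + ((x%:R - 6) / 2 - i%:R) * Q ^ (e - 2 * i%:Z - 8).
Proof.
move=> xh ex ih; rewrite edge_sumE; [|lia..].
rewrite half_pred_even ifN ?addn0; last by apply/negP; lia.
rewrite natrD !natrM; congr (_ * _ + _).
  by rewrite (@powzE _ (2 * (x - 5) - 1 - (2 * i + 2))) //; lia.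
have -> : (x%:R - 6) / 2 - i%:R = (h - i)%N%:R :> rat.
  by rewrite xh natrB; [rewrite natrD natrM; field|lia].
have [->|hi] := eqVneq (h - i)%N 0%N; first by rewrite !mul0r.
by congr (_ * _); rewrite (@powzE _ (2 * (x - 5) - 2 * h - 2 - (2 * i + 2))) //; lia.
Qed.

(* For [i = h + 1] the last two terms of the right-hand side are opposite powers of
   exponent -1. *)
Lemma edge_sum_odd_x_odd (x i : nat) (e : int) : x = (2 * h + 7)%N -> e = x%:Z ->
  (1 <= i <= h.+1)%N ->
  (edge_sum q h (x - 5) (2 * i + 1))%:R =
  i%:R * Q ^ (2 * e - 2 * i%:Z - 12) + ((x%:R - 7) / 2 - i%:R) * Q ^ (e - 2 * i%:Z - 6)
  + Q ^ (((e - 7) %/ 2)%Z - i%:Z).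
Proof.
move=> xh ex ih; rewrite edge_sumE; [|lia..].
have eh : ((e - 7) %/ 2)%Z = h by rewrite ex xh; lia.
have yh : (x%:R - 7) / 2 = h%:R :> rat by rewrite xh natrD natrM; field.
rewrite half_pred_odd eh yh 2!natrD !natrM -[LHS]addrA -[RHS]addrA; congr (_ * _ + _).
  by rewrite (@powzE _ (2 * (x - 5) - 1 - (2 * i + 1))) //; lia.
have [ih1|ih1] := eqVneq i h.+1.
  rewrite ifN ?addr0; last by apply/negP; lia.
  have -> : (h - i = 0)%N by lia.
  rewrite mul0r (_ : e - 2 * i%:Z - 6 = h%:Z - i%:Z); last lia.
  by rewrite ih1 -natr1; ring.
rewrite ifT; last by lia.
have -> : odd (2 * i + 1) by rewrite addn1 /= mul2n odd_double.
have -> : ((2 * i + 1 + 2 * h + 1)./2 = i + h + 1)%N by lia.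
rewrite -natrB; last lia.
congr (_ * _ + _).
  by rewrite (@powzE _ (2 * (x - 5) - 2 * h - 2 - (2 * i + 1))) //; lia.
by rewrite (@powzE _ (x - 5 - (i + h + 1) - 1)) //; lia.
Qed.

Lemma edge_sum_odd_x_even (x i : nat) (e : int) : x = (2 * h + 7)%N -> e = x%:Z ->
  (1 <= i <= h)%N ->
  (edge_sum q h (x - 5) (2 * i + 2))%:R =
  i%:R * Q ^ (2 * e - 2 * i%:Z - 13) + ((x%:R - 7) / 2 - i%:R) * Q ^ (e - 2 * i%:Z - 7)
  + Q ^ (e - i%:Z - 7).
Proof.
move=> xh ex ih; rewrite edge_sumE; [|lia..].
have yh : (x%:R - 7) / 2 = h%:R :> rat by rewrite xh natrD natrM; field.
rewrite half_pred_even yh 2!natrD !natrM -[LHS]addrA -[RHS]addrA; congr (_ * _ + _).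
  by rewrite (@powzE _ (2 * (x - 5) - 1 - (2 * i + 2))) //; lia.
rewrite ifT; last by lia.
have -> : odd (2 * i + 2) = false by rewrite addn2 /= mul2n odd_double.
have -> : ((2 * i + 2)./2 = i + 1)%N by lia.
rewrite -natrB; last lia.
congr (_ * _ + _).
  by rewrite (@powzE _ (2 * (x - 5) - 2 * h - 2 - (2 * i + 2))) //; lia.
by rewrite (@powzE _ (x - 5 - (i + 1) - 1)) //; lia.
Qed.

End EdgeSumFormulas.

Definition edge_classes (q x : nat) : seq nat :=
  ([:: 3; 4; 5] ++
   [seq 2 * i + 1 | i <- index_iota 3 (minn (uphalf q + 2) (x - 5)./2).+1] ++
   [seq 2 * i + 2 | i <- index_iota 2 (minn (q./2 + 2) (uphalf (x - 7))).+1])%N.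

Lemma edge_classes_bound q x s : (12 <= x)%N -> s \in edge_classes q x ->
  (3 <= s <= minn (q + 6) (x - 5 + 1))%N.
Proof.
move=> x12; rewrite !mem_cat => /or3P[|/mapP[i]|/mapP[i]].
- by rewrite !inE; lia.
- by rewrite mem_index_iota => ii ->; lia.
by rewrite mem_index_iota => ii ->; lia.
Qed.

Lemma edge_classes_uniq q x : uniq (edge_classes q x).
Proof.
rewrite !cat_uniq /= !map_inj_uniq ?iota_uniq; try by move=> i j; lia.
rewrite !andbT /=; apply/andP; split; apply/hasPn => s.
  rewrite mem_cat => /orP[] /mapP[i]; rewrite mem_index_iota !inE => ii ->; lia.
by move=> /mapP[i] _ ->; apply/negP => /mapP[j] _; lia.
Qed.

Definition level_size (q h m : nat) (sl : seq nat) : nat :=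
  (\sum_(s <- sl) (q ^ (2 * (m - 2) + head_dots s false) + q ^ (2 * (m - 2) + head_dots s true))
     * edge_sum q h m s)%N.

Lemma level_sizeE q h m sl :
  (\sum_(s <- sl) \sum_(b <- [:: false; true]) \sum_(e <- edges h m s)
     q ^ (2 * (m - 2) + head_dots s b + (m - e.1 - 1) + (m - e.2)))%N = level_size q h m sl.
Proof.
apply: eq_bigr => s _; rewrite big_cons big_seq1 mulnDl /edge_sum.
by congr (_ + _)%N; rewrite big_distrr; apply: eq_bigr => e _ /=; rewrite -expnD addnA.
Qed.

Lemma head_dots_ge6 s b : (6 <= s)%N -> head_dots s b = if b then 0%N else 2%N.
Proof. by move: s => [|[|[|[|[|[|s]]]]]]. Qed.

Lemma level_size_edge_classes q h x :
  level_size q h (x - 5) (edge_classes q x) =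
  ((q ^ (2 * (x - 7) + 4) + q ^ (2 * (x - 7))) * edge_sum q h (x - 5) (2 * 1 + 1)
  + (q ^ (2 * (x - 7) + 3) + q ^ (2 * (x - 7) + 1)) * edge_sum q h (x - 5) (2 * 1 + 2)
  + (q ^ (2 * (x - 7) + 2) + q ^ (2 * (x - 7) + 1)) * edge_sum q h (x - 5) (2 * 2 + 1)
  + (q ^ (2 * (x - 7) + 2) + q ^ (2 * (x - 7)))
    * (\sum_(3 <= i < (minn (uphalf q + 2) (x - 5)./2).+1) edge_sum q h (x - 5) (2 * i + 1)
     + \sum_(2 <= i < (minn (q./2 + 2) (uphalf (x - 7))).+1) edge_sum q h (x - 5) (2 * i + 2)))%N.
Proof.
rewrite /level_size !big_cat !big_cons big_nil !big_map /= addn0 -subnDA mulnDr !big_distrr /=.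
rewrite !addn0 !addnA; congr (_ + _ + _)%N; apply: eq_big_nat => i /andP[i_ge _].
  by rewrite !head_dots_ge6 ?addn0 //; lia.
by rewrite !head_dots_ge6 ?addn0 //; lia.
Qed.

Lemma M_evenE q h x : (12 <= x)%N -> x = (2 * h + 6)%N ->
  M_even q x = (q ^ (4 * (x - 5)) + level_size q h (x - 5) (edge_classes q x))%N%:R.
Proof.
move=> x12 xh; rewrite level_size_edge_classes /M_even.
set Q : rat := q%:R; set y : rat := x%:R; set e : int := x.
rewrite !(natrD, natrM) !addrA.
have f_odd i := @edge_sum_even_x_odd q h x i e xh erefl.
have f_even i := @edge_sum_even_x_even q h x i e xh erefl.
rewrite -/Q -/y in f_odd f_even.
congr (_ + (_ + _) * _ + (_ + _) * _ + (_ + _) * _ + (_ + _) * (_ + _));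
  try by apply: powzE; lia.
- rewrite f_odd; last lia.
  have -> : 2 * e - 2 * 1%:Z - 12 = 2 * e - 14 by lia.
  by have -> : e - 2 * 1%:Z - 7 = e - 9 by [lia]; field.
- rewrite f_even; last lia.
  have -> : 2 * e - 2 * 1%:Z - 13 = 2 * e - 15 by lia.
  by have -> : e - 2 * 1%:Z - 8 = e - 10 by [lia]; field.
- rewrite f_odd; last lia.
  have -> : 2 * e - 2 * 2%:Z - 12 = 2 * e - 16 by lia.
  by have -> : e - 2 * 2%:Z - 7 = e - 11 by [lia]; field.
- by rewrite [RHS]natr_sum; apply: eq_big_nat => i ii; rewrite f_odd //; lia.
by rewrite [RHS]natr_sum; apply: eq_big_nat => i ii; rewrite f_even //; lia.
Qed.

(* Only an inequality: for odd [x] the class [s = 5] contains two pairs of sum 5,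
   while [M_odd] accounts for one. *)
Lemma M_odd_le q h x : (12 <= x)%N -> x = (2 * h + 7)%N ->
  M_odd q x <= (q ^ (4 * (x - 5)) + level_size q h (x - 5) (edge_classes q x))%N%:R.
Proof.
move=> x12 xh; rewrite level_size_edge_classes /M_odd.
set Q : rat := q%:R; set y : rat := x%:R; set e : int := x.
rewrite !(natrD, natrM) !addrA.
have f_odd i := @edge_sum_odd_x_odd q h x i e xh erefl.
have f_even i := @edge_sum_odd_x_even q h x i e xh erefl.
rewrite -/Q -/y in f_odd f_even.
have Q_ge0 z : 0 <= Q ^ z by rewrite exprz_ge0 // ler0n.
rewrite lerD //; last first.
  rewrite le_eqVlt; apply/orP; left; apply/eqP.
  congr ((_ + _) * (_ + _)); try by apply: powzE; lia.
  - by rewrite [RHS]natr_sum; apply: eq_big_nat => i ii; rewrite f_odd //; lia.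
  by rewrite [RHS]natr_sum; apply: eq_big_nat => i ii; rewrite f_even //; lia.
rewrite lerD //.
  rewrite le_eqVlt; apply/orP; left; apply/eqP.
  congr (_ + (_ + _) * _ + (_ + _) * _); try by apply: powzE; lia.
  - rewrite f_odd; last lia.
    have -> : 2 * e - 2 * 1%:Z - 12 = 2 * e - 14 by lia.
    have -> : ((e - 7) %/ 2)%Z - 1%:Z = ((e - 9) %/ 2)%Z by lia.
    by have -> : e - 2 * 1%:Z - 6 = e - 8 by [lia]; field.
  rewrite f_even; last lia.
  have -> : 2 * e - 2 * 1%:Z - 13 = 2 * e - 15 by lia.
  have -> : e - 1%:Z - 7 = e - 8 by lia.
  by have -> : e - 2 * 1%:Z - 7 = e - 9 by [lia]; field.
have -> : (q ^ (2 * (x - 7) + 2))%N%:R = Q ^ (2 * e - 12).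
  by rewrite (@powzE q (2 * (x - 7) + 2)) //; lia.
have -> : (q ^ (2 * (x - 7) + 1))%N%:R = Q ^ (2 * e - 13).
  by rewrite (@powzE q (2 * (x - 7) + 1)) //; lia.
rewrite ler_wpM2l ?addr_ge0 // f_odd; last lia.
have -> : 2 * e - 2 * 2%:Z - 12 = 2 * e - 16 by lia.
have -> : ((e - 7) %/ 2)%Z - 2%:Z = ((e - 11) %/ 2)%Z by lia.
have -> : e - 2 * 2%:Z - 6 = e - 10 by lia.
have := Q_ge0 (2 * e - 16); lra.
Qed.

Lemma M_le q h x : (12 <= x)%N -> (2 * h + 6 <= x <= 2 * h + 7)%N ->
  M q x <= (q ^ (4 * (x - 5)) + level_size q h (x - 5) (edge_classes q x))%N%:R.
Proof.
move=> x12 hx; have ox := odd_double_half x.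
rewrite /M; case: ifP => odx; rewrite odx in ox.
  by apply: M_odd_le => //; lia.
by rewrite (M_evenE q (h := h)) //; lia.
Qed.

Lemma M1_rec q n : (12 <= n)%N ->
  M1 q n = M q n + (if (n < 17)%N then 0 else M1 q (n - 5)).
Proof.
move=> n12; rewrite /M1 big_nat_recl // muln0 subn0; congr (_ + _).
case: ltnP => n17; first by rewrite divn_small ?big_geq //; lia.
rewrite (_ : (n - 12) %/ 5 = (n - 5 - 12) %/ 5 + 1)%N; last lia.
by rewrite addn1; apply: eq_bigr => j _; congr (M q _); lia.
Qed.

Lemma code_exists (F : finFieldType) (n : nat) : (7 <= n)%N ->
  exists C : {set {vspace 'rV[F]_n}}, good_code C /\
  (if (n < 12)%N then (#|F| ^ 5 <= #|C|)%N : Prop else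
    M1 #|F| n + (#|F| ^ 5)%N%:R <= #|C|%:R /\
    exists D : {vspace 'M[F]_(5, n - 5)}, is_MRD 2 D /\ lifted_code D \subset C).
Proof.
elim/ltn_ind: n => n IHn n7; case: ltnP => [n12|n12].
  have [C [cC dC capC]] := @two_column_code F 5 n isT n7.
  by exists C; split; [split|rewrite cC].
have [m nE] : exists m, n = (m + 5)%N by exists (n - 5)%N; lia.
subst n; have m7 : (7 <= m)%N by lia.
have [|C0 [gC0 cC0]] := IHn m _ m7; first by lia.
pose h := (m.-1)./2.
have hm : (2 * h + 1 <= m <= 2 * h + 2)%N by rewrite /h; lia.
have clP s : s \in edge_classes #|F| (m + 5) -> (3 <= s <= minn (#|F| + 6) (m + 1))%N.
  by move=> /(edge_classes_bound n12); rewrite addnK.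
have clP' s : s \in edge_classes #|F| (m + 5) -> (3 <= s <= m + 1)%N.
  by move=> /clP; rewrite leq_min => /and3P[-> _ ->].
have [s sP|s e sP|C [gC exD cC]] :=
  @level_code F h m _ (edges h m) C0 m7 hm (edge_classes_uniq #|F| (m + 5)) clP _ _ gC0.
- by apply: edges_uniq hm (clP' s sP).
- by apply: edgesP hm (clP' s sP).
exists C; split => //; split => //.
rewrite cC level_sizeE M1_rec // natrD -[X in X <= _]addrA lerD //.
  have := @M_le #|F| h (m + 5) n12; rewrite addnK; apply; lia.
move: cC0; rewrite addnK (_ : (m + 5 < 17) = (m < 12))%N; last by lia.
by case: ifP => _; [rewrite add0r ler_nat|case].
Qed.

Theorem theorem3p16 (F : finFieldType) (q n : nat)
    (hq : #|F| = q) (hn : (12 <= n)%N) :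
  M1 q n + (q ^ 4 + q ^ 3 + q ^ 2 + q + 1)%N%:R <= (Abar F n 4 5)%:R.
Proof.
have [|C [[dC capC]]] := @code_exists F n; first by lia.
rewrite ltnNge hn /= hq => -[le_C [D [mrdD sDC]]].
have q_gt1 : (1 < q)%N by rewrite -hq finNzRing_gt1.
apply: le_trans (_ : M1 q n + (q ^ 5)%N%:R <= _).
  rewrite lerD2l ler_nat; nia.
apply: le_trans le_C _; rewrite ler_nat.
refine (@leq_bigmax_cond _ _ _ C _).
apply/andP; split; last by apply/existsP; exists D; rewrite mrdD.
apply/andP; split; first by apply/subsetP => U UC; rewrite inE dC.
apply/forall_inP => U UC; apply/forall_inP => V VC; apply/implyP => UV.
rewrite /subspace_dist (dC U UC) (dC V VC); have := capC U V UC VC UV.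
by case: (\dim (U :&: V)) => [|[|[|[|]]]].
Qed.
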